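(* Let the splitting assumption (stated in the context) be satisfied and let $A_{11}$ be everywhere defined and bounded. Assume moreover that $A_{\mathrm{ext}}$ generates a contractive $C_0$-semigroup on $H_1 \times H_2$ and that $\operatorname{dom}(A_{21})$, endowed with the graph norm $\|\cdot\|_{A_{21}}$, embeds compactly into $H_1$. (a) The semigroup $(e^{tA_S})_{t \ge 0}$ is exponentially stable if and only if $\ker A_{21} \cap \ker(\mathrm{i}\omega - A_{11}) = \{0\}$ for each $\omega \in \mathbb{R}$. (b) The semigroup $(e^{tA_S})_{t \ge 0}$ converges with respect to the operator norm as $t \to \infty$ if and only if $\ker A_{21} \cap \ker(\mathrm{i}\omega - A_{11}) = \{0\}$ for each $\omega \in \mathbb{R} \setminus \{0\}$. In this case the limit operator as $t \to \infty$ is the orthogonal projection onto $\ker A_{21} \cap \ker A_{11}$.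
   Context: Inner products on complex Hilbert spaces are linear in the first and antilinear in the second component. Let $H_1, H_2$ be non-zero complex Hilbert spaces, let $A_1: \operatorname{dom}(A_1) \subseteq H_1 \times H_2 \to H_1$ and $A_{21}: \operatorname{dom}(A_{21}) \subseteq H_1 \to H_2$ be linear operators (defined on vector subspaces), and let $S: H_2 \to H_2$ be a bounded linear operator that is coercive: there is $\nu > 0$ with $\operatorname{Re}(h_2 | S h_2)_{H_2} \ge \nu \|h_2\|_{H_2}^2$ for all $h_2 \in H_2$. The operator $A_{\mathrm{ext}}$ on $H_1 \times H_2$ has domain $\operatorname{dom}(A_{\mathrm{ext}}) = \{ (h_1,h_2) \in \operatorname{dom}(A_1) : h_1 \in \operatorname{dom}(A_{21}) \}$ and acts as $A_{\mathrm{ext}}(h_1,h_2) = (A_1(h_1,h_2),\, A_{21}h_1)$. The operator $A_S$ on $H_1$ has domain $\operatorname{dom}(A_S) = \{ h_1 \in \operatorname{dom}(A_{21}) : (h_1, S A_{21} h_1) \in \operatorname{dom}(A_1) \}$ and acts as $A_S h_1 = A_1 (h_1, S A_{21} h_1)$. (Known theorem of Zwart, Le Gorrec and Maschke: if $A_{\mathrm{ext}}$ generates a contractive $C_0$-semigroup on $H_1\times H_2$, then $A_S$ generates a contractive $C_0$-semigroup $(e^{tA_S})_{t\ge 0}$ on $H_1$.) Splitting assumption: $\operatorname{dom}(A_1) = \operatorname{dom}(A_{11}) \times \operatorname{dom}(A_{12})$ for vector subspaces $\operatorname{dom}(A_{11}) \subseteq H_1$, $\operatorname{dom}(A_{12})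 \subseteq H_2$, hence $A_1(h_1,h_2) = A_{11}h_1 + A_{12}h_2$ with linear operators $A_{11}: \operatorname{dom}(A_{11}) \subseteq H_1 \to H_1$ and $A_{12}: \operatorname{dom}(A_{12}) \subseteq H_2 \to H_1$. The graph norm is $\|u\|_{A_{21}}^2 = \|A_{21}u\|_{H_2}^2 + \|u\|_{H_1}^2$. A $C_0$-semigroup is exponentially stable if it converges to $0$ with respect to the operator norm as $t \to \infty$. *)

(* Defs.v *)
From HB Require Import structures.
From mathcomp Require Import all_boot all_order all_algebra.
From mathcomp Require Import all_classical all_reals all_analysis.
From mathcomp Require Import complex ring.
Set Implicit Arguments.
Unset Strict Implicit.
Unset Printing Implicit Defensive.
Import Order.TTheory GRing.Theory Num.Theory numFieldNormedType.Exports.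
Local Open Scope classical_set_scope.
Local Open Scope ring_scope.

(* The forms of [{dot H for conj}] are linear in the
   first and antilinear in the second argument. *)
HB.mixin Record CompleteNormedModule_isHilbert (R : realType) H
    & CompleteNormedModule R[i] H := {
  inner : {dot H for (@Num.conj R[i])};
  inner_norm : forall x : H, inner x x = `|x| ^+ 2
}.

#[short(type="hilbertType")]
HB.structure Definition Hilbert (R : realType) :=
  { H of CompleteNormedModule R[i] H & CompleteNormedModule_isHilbert R H }.

(* The library norm of a space over [R[i]] takes its values in [R[i]]; they are
   real, and [rnorm] is the same norm with values in [R]. *)
Definition rnorm (R : realType) (H : normedModType R[i]) (x : H) : R :=
  complex.Re `|x|.

(* The Hilbert space product. It is an alias of [H1 * H2] because the library
   equips the latter with the maximum norm. *)
Definition hprod (R : realType) (H1 H2 : hilbertType R) : Type :=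
  (H1 * H2)%type.

Section hprod_hilbert.
Context (R : realType) (H1 H2 : hilbertType R).
Local Notation C := R[i].
Local Notation HH := (hprod H1 H2).

HB.instance Definition _ := GRing.Lmodule.on HH.

Definition hprod_inner (x y : HH) : C := inner x.1 y.1 + inner x.2 y.2.

Definition hprod_norm (x : HH) : C := sqrtC (`|x.1| ^+ 2 + `|x.2| ^+ 2).

Lemma hprod_sqnorm_ge0 (x : HH) : 0 <= `|x.1| ^+ 2 + `|x.2| ^+ 2.
Proof. by rewrite addr_ge0 ?exprn_ge0. Qed.

Lemma hprod_norm_ge0 x : 0 <= hprod_norm x.
Proof. by rewrite sqrtC_ge0 hprod_sqnorm_ge0. Qed.

Lemma hprod_norm_sq x : hprod_norm x ^+ 2 = `|x.1| ^+ 2 + `|x.2| ^+ 2.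
Proof. exact: sqrtCK. Qed.

Lemma hprod_norm_le (x : HH) (e : C) :
  0 <= e -> (hprod_norm x <= e) = (`|x.1| ^+ 2 + `|x.2| ^+ 2 <= e ^+ 2).
Proof.
by move=> e0; rewrite -hprod_norm_sq ler_sqr// nnegrE ?hprod_norm_ge0.
Qed.

Lemma hprod_norm_triangle (x y : HH) :
  hprod_norm (x + y) <= hprod_norm x + hprod_norm y.
Proof.
have [nx ny] := (hprod_norm_ge0 x, hprod_norm_ge0 y).
rewrite hprod_norm_le ?addr_ge0// sqrrD !hprod_norm_sq /=.
pose a1 := `|x.1|; pose a2 := `|x.2|; pose b1 := `|y.1|; pose b2 := `|y.2|.
have leD (V : normedModType C) (u v : V) :
    `|u + v| ^+ 2 <= (`|u| + `|v|) ^+ 2.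
  by rewrite ler_sqr ?nnegrE ?addr_ge0// ler_normD.
apply: (le_trans (lerD (leD _ _ _) (leD _ _ _))).
rewrite -/a1 -/a2 -/b1 -/b2 !sqrrD.
have cs2 : (a1 * b1 + a2 * b2) ^+ 2 <= (hprod_norm x * hprod_norm y) ^+ 2.
  rewrite exprMn !hprod_norm_sq -/a1 -/a2 -/b1 -/b2 -subr_ge0.
  have -> : (a1 ^+ 2 + a2 ^+ 2) * (b1 ^+ 2 + b2 ^+ 2) -
     (a1 * b1 + a2 * b2) ^+ 2 = (a1 * b2 - a2 * b1) ^+ 2 by ring.
  by rewrite real_exprn_even_ge0// realB ?realM ?normr_real.
have cs : a1 * b1 + a2 * b2 <= hprod_norm x * hprod_norm y.
  have pq0 : 0 <= hprod_norm x * hprod_norm y by exact: mulr_ge0.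
  have ab0 : 0 <= a1 * b1 + a2 * b2 by rewrite addr_ge0 ?mulr_ge0 ?normr_ge0.
  by rewrite ler_sqr in cs2.
rewrite -subr_ge0.
have -> : a1 ^+ 2 + a2 ^+ 2 + hprod_norm x * hprod_norm y *+ 2 +
    (b1 ^+ 2 + b2 ^+ 2) -
    (a1 ^+ 2 + a1 * b1 *+ 2 + b1 ^+ 2 + (a2 ^+ 2 + a2 * b2 *+ 2 + b2 ^+ 2)) =
    (hprod_norm x * hprod_norm y - (a1 * b1 + a2 * b2)) *+ 2 by ring.
by rewrite mulrn_wge0// subr_ge0.
Qed.

Lemma hprod_normZ (l : C) (x : HH) : hprod_norm (l *: x) = `|l| * hprod_norm x.
Proof.
rewrite /hprod_norm /= !normrZ !exprMn -mulrDr sqrtCM ?nnegrE ?exprn_ge0//.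
by rewrite sqrCK.
Qed.

Lemma hprod_norm0_eq0 (x : HH) : hprod_norm x = 0 -> x = 0.
Proof.
move=> /eqP; rewrite sqrtC_eq0 paddr_eq0 ?exprn_ge0// !sqrf_eq0 !normr_eq0.
by case: x => a b /= /andP[/eqP -> /eqP ->].
Qed.

HB.instance Definition _ := Lmodule_isNormed.Build C HH
  hprod_norm_triangle hprod_normZ hprod_norm0_eq0.

Lemma hprod_normE (x : HH) : `|x| = sqrtC (`|x.1| ^+ 2 + `|x.2| ^+ 2).
Proof. by []. Qed.

Lemma hprod_norm1_le (x : HH) : `|x.1| <= `|x|.
Proof.
by rewrite -ler_sqr ?nnegrE// [in leRHS]hprod_norm_sq lerDl exprn_ge0.
Qed.

Lemma hprod_norm2_le (x : HH) : `|x.2| <= `|x|.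
Proof.
by rewrite -ler_sqr ?nnegrE// [in leRHS]hprod_norm_sq lerDr exprn_ge0.
Qed.

Lemma hprod_norm_leD (x : HH) : `|x| <= `|x.1| + `|x.2|.
Proof.
rewrite [leLHS]/(hprod_norm x) hprod_norm_le ?addr_ge0// sqrrD.
by rewrite -addrA lerD2l lerDr mulrn_wge0// mulr_ge0.
Qed.

Lemma hprod_complete (F : set_system HH) : ProperFilter F -> cauchy F -> cvg F.
Proof.
move=> FF /cauchy_ballP Fc.
have c1 : cauchy (fst @ F : set_system H1).
  apply/cauchy_ballP => e e0; have := Fc e e0.
  move=> [[A B] [/= FA FB] AB].
  exists (fst @` A, fst @` B) => /=.
    split; [apply: filterS FA|apply: filterS FB] => z Az /=; by exists z.
  move=> [_ _] [/= [a Aa <-] [b Bb <-]].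
  have := AB (a, b) (conj Aa Bb); rewrite -!ball_normE /=.
  exact: le_lt_trans (hprod_norm1_le (a - b)).
have c2 : cauchy (snd @ F : set_system H2).
  apply/cauchy_ballP => e e0; have := Fc e e0.
  move=> [[A B] [/= FA FB] AB].
  exists (snd @` A, snd @` B) => /=.
    split; [apply: filterS FA|apply: filterS FB] => z Az /=; by exists z.
  move=> [_ _] [/= [a Aa <-] [b Bb <-]].
  have := AB (a, b) (conj Aa Bb); rewrite -!ball_normE /=.
  exact: le_lt_trans (hprod_norm2_le (a - b)).
have [l1 Fl1] : exists l : H1, fst @ F --> l.
  by exists (lim (fst @ F)); exact: cauchy_cvg.
have [l2 Fl2] : exists l : H2, snd @ F --> l.
  by exists (lim (snd @ F)); exact: cauchy_cvg.
apply/cvg_ex; exists ((l1, l2) : HH).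
apply/cvgrPdist_lt => e e0; near=> x.
apply: (le_lt_trans (hprod_norm_leD _)); rewrite /= [ltRHS]splitr ltrD//.
- near: x; have /cvgrPdist_lt := Fl1.
  by move=> /(_ (e / 2)); apply; rewrite divr_gt0.
- near: x; have /cvgrPdist_lt := Fl2.
  by move=> /(_ (e / 2)); apply; rewrite divr_gt0.
Unshelve. all: by end_near. Qed.

HB.instance Definition _ := Uniform_isComplete.Build HH hprod_complete.

Lemma hprod_inner_bilinear :
  bilinear_for *%R (@Num.conj C \; *%R) (hprod_inner : HH -> HH -> C).
Proof.
split=> u a x y; rewrite /hprod_inner /=.
  by rewrite !linearPl/= mulrDr addrACA.
by rewrite !linearPr/= mulrDr addrACA.
Qed.

HB.instance Definition _ := bilinear_isBilinear.Build _ _ _ _ _ _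
  hprod_inner hprod_inner_bilinear.

Lemma hprod_inner_herm (x y : HH) :
  hprod_inner x y = (-1) ^+ false * Num.conj (hprod_inner y x).
Proof.
rewrite expr0 mul1r /hprod_inner rmorphD /=.
by rewrite (hermC inner x.1) (hermC inner x.2) !expr0 !mul1r.
Qed.

HB.instance Definition _ := isHermitianSesquilinear.Build _ _ false
  (@Num.conj C) hprod_inner hprod_inner_herm.

Lemma hprod_inner_norm (x : HH) : hprod_inner x x = `|x| ^+ 2.
Proof. by rewrite /hprod_inner !inner_norm [in RHS]hprod_norm_sq. Qed.

Lemma hprod_inner_gt0 (x : HH) : x != 0 -> 0 < hprod_inner x x.
Proof. by move=> x0; rewrite hprod_inner_norm exprn_gt0 ?normr_gt0. Qed.

HB.instance Definition _ := isDotProduct.Build C HH hprod_inner hprod_inner_gt0.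

HB.instance Definition _ := CompleteNormedModule_isHilbert.Build R HH
  hprod_inner_norm.

End hprod_hilbert.

(* Linear operators [A : dom(A) \subseteq E -> F]. The values of the total
   function [op_fun A] outside [op_dom A] carry no meaning. *)
Record lin_op (K : pzRingType) (E F : lmodType K) := LinOp {
  op_dom : set E;
  op_fun :> E -> F;
  op_dom0 : op_dom 0;
  op_domP : forall (a : K) (x y : E),
    op_dom x -> op_dom y -> op_dom (a *: x + y);
  op_linear : forall (a : K) (x y : E),
    op_dom x -> op_dom y -> op_fun (a *: x + y) = a *: op_fun x + op_fun y
}.

Definition op_ker (K : pzRingType) (E F : lmodType K) (A : lin_op E F) :
  set E := [set x | op_dom A x /\ A x = 0].

Section shift.
Context (K : comPzRingType) (E : lmodType K) (l : K) (A : lin_op E E).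

Lemma shift_op_linear (a : K) (x y : E) : op_dom A x -> op_dom A y ->
  l *: (a *: x + y) - A (a *: x + y) = a *: (l *: x - A x) + (l *: y - A y).
Proof.
move=> dx dy; rewrite op_linear// scalerDr scalerBr !scalerA (mulrC l a).
by rewrite opprD addrACA.
Qed.


Definition shift_op : lin_op E E :=
  LinOp (op_dom0 A) (@op_domP _ _ _ A) shift_op_linear.

End shift.

Section system_operators.
Context (R : realType) (H1 H2 : hilbertType R).
Variables (A1 : lin_op (hprod H1 H2) H1) (A21 : lin_op H1 H2).
Variable S : {linear H2 -> H2}.

Definition Aext_dom : set (hprod H1 H2) :=
  [set h | op_dom A1 h /\ op_dom A21 h.1].

Definition Aext_fun (h : hprod H1 H2) : hprod H1 H2 := (A1 h, A21 h.1).

Lemma Aext_dom0 : Aext_dom 0.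
Proof. by split; exact: op_dom0. Qed.

Lemma Aext_domP (a : R[i]) (x y : hprod H1 H2) :
  Aext_dom x -> Aext_dom y -> Aext_dom (a *: x + y).
Proof. by move=> [x1 x2] [y1 y2]; split; exact: op_domP. Qed.

Lemma Aext_linear (a : R[i]) (x y : hprod H1 H2) :
  Aext_dom x -> Aext_dom y ->
  Aext_fun (a *: x + y) = a *: Aext_fun x + Aext_fun y.
Proof.
by move=> [x1 x2] [y1 y2]; congr pair; rewrite op_linear.
Qed.

Definition Aext : lin_op (hprod H1 H2) (hprod H1 H2) :=
  LinOp Aext_dom0 Aext_domP Aext_linear.

Definition AS_arg (h : H1) : hprod H1 H2 := (h, S (A21 h)).

Definition AS_dom : set H1 := [set h | op_dom A21 h /\ op_dom A1 (AS_arg h)].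

Definition AS_fun (h : H1) : H1 := A1 (AS_arg h).

Lemma AS_argP (a : R[i]) (x y : H1) : op_dom A21 x -> op_dom A21 y ->
  AS_arg (a *: x + y) = a *: AS_arg x + AS_arg y.
Proof. by move=> dx dy; rewrite /AS_arg op_linear// linearP. Qed.

Lemma op_fun0 (K : pzRingType) (E F : lmodType K) (A : lin_op E F) : A 0 = 0.
Proof.
have := op_linear 1 (op_dom0 A) (op_dom0 A).
by rewrite !scale1r addr0 -[X in X = _]addr0 => /addrI.
Qed.

Lemma AS_dom0 : AS_dom 0.
Proof.
split; first exact: op_dom0.
by rewrite /AS_arg op_fun0 linear0; exact: op_dom0.
Qed.

Lemma AS_domP (a : R[i]) (x y : H1) :
  AS_dom x -> AS_dom y -> AS_dom (a *: x + y).
Proof.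
move=> [x1 x2] [y1 y2]; split; first exact: op_domP.
by rewrite AS_argP//; exact: op_domP.
Qed.

Lemma AS_linear (a : R[i]) (x y : H1) : AS_dom x -> AS_dom y ->
  AS_fun (a *: x + y) = a *: AS_fun x + AS_fun y.
Proof.
by move=> [x1 x2] [y1 y2]; rewrite /AS_fun AS_argP// op_linear.
Qed.

Definition AS : lin_op H1 H1 := LinOp AS_dom0 AS_domP AS_linear.

Definition splitting (A11 : lin_op H1 H1) (A12 : lin_op H2 H1) : Prop :=
  op_dom A1 = [set h : hprod H1 H2 | op_dom A11 h.1 /\ op_dom A12 h.2] /\
  forall h : hprod H1 H2, op_dom A1 h -> A1 h = A11 h.1 + A12 h.2.

Definition graph_norm (u : H1) : R :=
  Num.sqrt (rnorm (A21 u) ^+ 2 + rnorm u ^+ 2).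

(* The embedding [dom(A21) -> H1] maps the closed unit ball of the graph norm to
   a relatively compact set. *)
Definition graph_embeds_compactly : Prop :=
  precompact [set u : H1 | op_dom A21 u /\ graph_norm u <= 1].

End system_operators.

Section bounded_operators.
Context (R : realType) (E F : hilbertType R).

Definition bounded_op (f : E -> F) : Prop :=
  exists M : R, forall x : E, rnorm (f x) <= M * rnorm x.

Definition op_norm (f : E -> F) : \bar R :=
  ereal_sup [set (rnorm (f x))%:E | x in [set x : E | rnorm x <= 1]].

End bounded_operators.

Definition coercive (R : realType) (H : hilbertType R) (S : H -> H) : Prop :=
  exists2 nu : R, 0 < nu &
    forall h : H, nu * rnorm h ^+ 2 <= complex.Re (inner h (S h)).

(* Semigroups are families [T t] indexed by [R] of which only the members with
   [0 <= t] matter. *)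
Section semigroups.
Context (R : realType) (H : hilbertType R).

Record C0_semigroup (T : R -> {linear H -> H}) : Prop := C0Semigroup {
  semigroup_bounded : forall t : R, 0 <= t -> bounded_op (T t);
  semigroup0 : forall x : H, T 0 x = x;
  semigroupD : forall (s t : R) (x : H),
    0 <= s -> 0 <= t -> T (s + t) x = T s (T t x);
  semigroup_continuous : forall x : H,
    {within [set t : R | 0 <= t], continuous (fun t : R => T t x)}
}.

Definition contractive (T : R -> {linear H -> H}) : Prop :=
  forall t : R, 0 <= t -> (op_norm (T t) <= 1)%E.

(* [A] and the generator of [T] have the same graph. *)
Definition is_generator (T : R -> {linear H -> H}) (A : lin_op H H) : Prop :=
  forall x y : H, (op_dom A x /\ A x = y) <->
    ((h^-1)%:C%C *: (T h x - x) @[h --> (0 : R)^'+] --> y).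

Definition generates_contractive_C0_semigroup (A : lin_op H H) : Prop :=
  exists T : R -> {linear H -> H},
    [/\ C0_semigroup T, contractive T & is_generator T A].

Definition op_norm_cvg (T : R -> {linear H -> H}) (P : {linear H -> H}) : Prop :=
  op_norm (T t \- P) @[t --> +oo%R] --> 0%E.

Definition exponentially_stable (T : R -> {linear H -> H}) : Prop :=
  op_norm_cvg T \0.

Definition is_orthogonal_projection (M : set H) (P : H -> H) : Prop :=
  forall x : H, M (P x) /\ forall y : H, M y -> inner (x - P x) y = 0.

End semigroups.

(* Main.v *)
Require Import Defs.
From HB Require Import structures.
From mathcomp Require Import all_boot all_order all_algebra.
From mathcomp Require Import all_classical all_reals all_analysis.
From mathcomp Require Import complex.
From mathcomp Require Import ring lra.
Set Implicit Arguments.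
Unset Strict Implicit.
Unset Printing Implicit Defensive.
Import Order.TTheory GRing.Theory Num.Theory numFieldNormedType.Exports.
Local Open Scope classical_set_scope.
Local Open Scope ring_scope.

(** The energy balance of the extended system, evaluated at [(x, S (A21 x))],
    says that [Re (AS x | x) <= - nu * |A21 x| ^ 2] ([AS_dissipative]). So [T] is
    a contraction semigroup, and the norm of an orbit decreases at least at the
    rate given by [|A21 x| ^ 2]. Everything rests on two consequences.

    The operator [T 1] is compact ([time_one_compact]). An orbit starting in the
    unit ball has only a bounded amount of energy to dissipate, so at some time
    in [[0, 1]] it is in a fixed ball of the graph norm of [A21], which is
    relatively compact in [H1]; from there on the orbit depends continuously on
    the remaining time and on that point.

    The vectors on which the semigroup is isometric form a closed invariant
    subspace [M] along whose orbits nothing is dissipated. As [A21] is closed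
    (which follows from [Aext] being closed and [A11] bounded), [M] is contained
    in [ker A21] ([isometric_part_ker21]). There [AS] coincides with [A11], and
    the graph norm with the norm, so [M] has a compact unit ball and [A11] is a
    bounded skew-adjoint operator on it. If [A11] is not zero on [M], a vector of
    the unit ball at which [|A11 y|] is maximal yields an eigenvector for an
    eigenvalue [i w] with [w] nonzero ([isometric_part_A11_eq0]), which lies in
    [ker A21] and in the kernel of [i w - A11].

    If there are no such eigenvectors, then [A11] and thus [AS] vanish on [M],
    that is, [M] consists of fixed points. Every orbit has a cluster point by the
    compactness of [T 1]; it lies in [M] because norms decrease, so it is fixed,
    and a contraction semigroup whose orbit clusters at a fixed point converges
    to it ([orbit_converges]). The convergence is uniform on the relatively
    compact image of the unit ball under [T 1], hence holds in operator norm
    ([orbit_limit_uniform]). Limits of orbits are the elements of [ker AS], which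
    is the intersection of [ker A21] and [ker A11]; the limit is the orthogonal
    projection since a contraction preserves inner products with its fixed
    points ([limit_orthogonal_projection]). It is zero exactly in the
    exponentially stable case.

    Conversely an eigenvector [x] in [ker A21] for the eigenvalue [i w] of [A11]
    is one of [AS], so the norm of its orbit is constant ([eigenvector_isometric]),
    while a limit of that orbit would be both fixed and an eigenvector for
    [i w], hence zero if [w] is not ([eigenvector_limit0]).

    Two facts about semigroups are proved along the way. Differentiating from
    the right suffices for all energy arguments ([right_derivative_le]). The
    domain of a generator is dense ([generator_dense]) because it contains the
    means of orbits over short intervals, which are taken as limits of dyadic
    Riemann sums. *)

(** * The underlying real Hilbert space *)

Lemma subrACA (V : zmodType) (a b c d : V) : (a - b) - (c - d) = (a - c) - (b - d).
Proof. by rewrite opprD addrACA -opprD. Qed.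

Lemma subr_telescope (V : zmodType) (a b c u v : V) :
  a - c - (u + v) = (b - c - u) + (a - b - v).
Proof.
by rewrite addrACA -opprD; congr (_ - _); rewrite [RHS]addrC addrA subrK.
Qed.

Section RealStructure.
Context (R : realType) (H : hilbertType R).
Implicit Types x y z : H.

(** Energy estimates only involve the real part of the inner product. They are
    carried out in the underlying real Hilbert space, with [rip] as its inner
    product and [rsc] as its scaling. *)
Definition rip x y : R := complex.Re (inner x y).

Definition rsc (r : R) x : H := r%:C%C *: x.

Lemma ReD (a b : R[i]) : complex.Re (a + b) = complex.Re a + complex.Re b.
Proof. by case: a b => ? ? [? ?]. Qed.

Lemma ReB (a b : R[i]) : complex.Re (a - b) = complex.Re a - complex.Re b.
Proof. by case: a b => ? ? [? ?]. Qed.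

Lemma Re_realM (r : R) (a : R[i]) :
  complex.Re (r%:C%C * a) = r * complex.Re a.
Proof. by case: a => a b /=; rewrite mul0r subr0. Qed.

Lemma rnormE x : `|x| = (rnorm x)%:C%C.
Proof. by rewrite /rnorm RRe_real// ger0_real. Qed.

Lemma rnorm_ge0 x : 0 <= rnorm x.
Proof. by rewrite -ler0c -rnormE. Qed.

Lemma rnorm0 : rnorm (0 : H) = 0.
Proof. by rewrite /rnorm normr0. Qed.

Lemma rnorm0_eq0 x : rnorm x = 0 -> x = 0.
Proof. by move=> x0; apply/eqP; rewrite -normr_eq0 rnormE x0. Qed.

Lemma rnormD x y : rnorm (x + y) <= rnorm x + rnorm y.
Proof. by rewrite -lecR rmorphD /= -!rnormE ler_normD. Qed.

Lemma rnormN x : rnorm (- x) = rnorm x.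
Proof. by rewrite /rnorm normrN. Qed.

Lemma rnormB x y : rnorm (x - y) = rnorm (y - x).
Proof. by rewrite -rnormN opprB. Qed.

Lemma rnorm_trans y x z : rnorm (x - z) <= rnorm (x - y) + rnorm (y - z).
Proof. by rewrite (le_trans _ (rnormD _ _))// addrA subrK. Qed.

Lemma rnormZ (r : R) x : 0 <= r -> rnorm (rsc r x) = r * rnorm x.
Proof.
move=> r0; apply: (@complexI R); rewrite -rnormE normrZ rnormE rmorphM.
by rewrite ger0_norm// ler0c.
Qed.

Lemma rscA (r s : R) x : rsc r (rsc s x) = rsc (r * s) x.
Proof. by rewrite /rsc scalerA rmorphM. Qed.

Lemma rscDr (r : R) x y : rsc r (x + y) = rsc r x + rsc r y.
Proof. exact: scalerDr. Qed.

Lemma rscDl (r s : R) x : rsc (r + s) x = rsc r x + rsc s x.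
Proof. by rewrite /rsc rmorphD scalerDl. Qed.

Lemma rscBl (r s : R) x : rsc (r - s) x = rsc r x - rsc s x.
Proof. by rewrite /rsc rmorphB scalerBl. Qed.

Lemma rscBr (r : R) x y : rsc r (x - y) = rsc r x - rsc r y.
Proof. exact: scalerBr. Qed.

Lemma linear_rsc (U : {linear H -> H}) (r : R) x : U (rsc r x) = rsc r (U x).
Proof. exact: linearZ. Qed.

Lemma rsc0l x : rsc 0 x = 0.
Proof. exact: scale0r. Qed.

Lemma rsc1 x : rsc 1 x = x.
Proof. exact: scale1r. Qed.

Lemma ripC x y : rip x y = rip y x.
Proof.
apply: (@complexI R); rewrite /rip (hermC inner) expr0 mul1r /=.
by rewrite !complexRe Re_conj.
Qed.

Lemma ripDl x y z : rip (x + y) z = rip x z + rip y z.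
Proof. by rewrite /rip linearDl ReD. Qed.

Lemma ripBl x y z : rip (x - y) z = rip x z - rip y z.
Proof. by rewrite /rip linearBl ReB. Qed.

Lemma ripZl (r : R) x y : rip (rsc r x) y = r * rip x y.
Proof. by rewrite /rip linearZl_LR /= Re_realM. Qed.

Lemma ripDr x y z : rip x (y + z) = rip x y + rip x z.
Proof. by rewrite !(ripC x) ripDl. Qed.

Lemma ripBr x y z : rip x (y - z) = rip x y - rip x z.
Proof. by rewrite !(ripC x) ripBl. Qed.

Lemma ripZr (r : R) x y : rip x (rsc r y) = r * rip x y.
Proof. by rewrite !(ripC x) ripZl. Qed.

Lemma rip0l x : rip 0 x = 0.
Proof. by rewrite -(rsc0l 0) ripZl mul0r. Qed.

Lemma ripxx x : rip x x = rnorm x ^+ 2.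
Proof.
rewrite /rip inner_norm rnormE -rmorphXn //.
Qed.

Lemma sqnormD x y :
  rnorm (x + y) ^+ 2 = rnorm x ^+ 2 + 2 * rip x y + rnorm y ^+ 2.
Proof. rewrite -!ripxx ripDl !ripDr (ripC y x); ring. Qed.

Lemma sqnormB x y :
  rnorm (x - y) ^+ 2 = rnorm x ^+ 2 - 2 * rip x y + rnorm y ^+ 2.
Proof. rewrite -!ripxx ripBl !ripBr (ripC y x); ring. Qed.

Lemma rip_le x y : rip x y <= rnorm x * rnorm y.
Proof.
have [y0|y0] := eqVneq (rnorm y) 0.
  by rewrite (rnorm0_eq0 y0) ripC rip0l rnorm0 mulr0.
have yp : 0 < rnorm y by rewrite lt0r y0 rnorm_ge0.
have := sqr_ge0 (rnorm (rsc (rnorm y) x - rsc (rnorm x) y)).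
rewrite sqnormB !rnormZ ?rnorm_ge0// ripZl ripZr => h.
have [x0|x0] := eqVneq (rnorm x) 0.
  by rewrite (rnorm0_eq0 x0) rip0l rnorm0 mul0r.
have xp : 0 < rnorm x by rewrite lt0r x0 rnorm_ge0.
have xyp : 0 < rnorm x * rnorm y by rewrite mulr_gt0.
rewrite -(ler_pM2l xyp); nra.
Qed.

Lemma rip_ge x y : - (rnorm x * rnorm y) <= rip x y.
Proof.
have := rip_le (- x) y; rewrite rnormN lerNl -[- x]sub0r ripBl rip0l sub0r.
by [].
Qed.

(** The second argument is multiplied by [1] and by [i] to recover the real and
    the imaginary part. *)
Lemma inner_rip0 x y : (forall a : R[i], rip x (a *: y) = 0) -> inner x y = 0.
Proof.
move=> xy; have := xy 1; have := xy 'i%C.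
rewrite scale1r /rip linearZr_LR /=.
by case: (inner x y) => a b /=; rewrite !mul0r !sub0r ?mul1r ?mulN1r ?opprK => -> ->.
Qed.

End RealStructure.

Lemma bounded_opP (R : realType) (E F : hilbertType R) (f : E -> F) :
  bounded_op f ->
  exists2 M : R, 0 < M & forall x, rnorm (f x) <= M * rnorm x.
Proof.
move=> [M fM]; exists (`|M| + 1) => [|x]; first by rewrite ltr_wpDl.
apply: (le_trans (fM x)); apply: ler_wpM2r; first exact: rnorm_ge0.
by rewrite (le_trans (ler_norm _))// lerDl.
Qed.

(** * Semigroups and their generators *)

(** A mean value inequality under a bound on the right upper derivative and left
    continuity only. An orbit of a semigroup is differentiated from the right
    without further ado, whereas its left derivative would need uniform bounds
    on the semigroup, which here are a consequence of the inequality. The proof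
    extends the estimate from [0] as far as possible, up to a slack [e]. *)
Lemma right_derivative_le (R : realType) (f : R -> R) (c b : R) : 0 <= b ->
  (forall t, 0 <= t <= b -> forall e : R, 0 < e -> exists2 d : R, 0 < d &
     forall s, 0 <= s <= t -> t - d < s -> f t - f s < e) ->
  (forall t, 0 <= t < b -> forall e : R, 0 < e -> exists2 d : R, 0 < d &
     forall h : R, 0 < h < d -> f (t + h) - f t <= (c + e) * h) ->
  f b - f 0 <= c * b.
Proof.
move=> b0 fc fd.
have key e : 0 < e -> f b - f 0 <= (c + e) * b.
  move=> e0.
  pose S := [set t | 0 <= t <= b /\ f t - f 0 <= (c + e) * t].
  have S0 : S 0 by split; rewrite ?lexx ?b0// mulr0 subrr.
  have hs : has_sup S by split; [exists 0|exists b => t [/andP[]]].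
  set u := sup S.
  have u0 : 0 <= u by apply: ub_le_sup => //; case: hs.
  have ub : u <= b by apply: ge_sup; [exists 0|move=> t [/andP[]]].
  have uS : S u.
    split; first by rewrite u0 ub.
    apply/ler_addgt0Pr => r r0.
    have [M M0 cM] : exists2 M : R, 0 < M & - M <= c + e.
      exists (`|c + e| + 1); first by rewrite ltr_wpDl.
      by rewrite lerNl -normrN (le_trans (ler_norm _))// lerDl.
    have [d d0 fcd] := fc u (introT andP (conj u0 ub)) _ (divr_gt0 r0 (ltr0n _ 2)).
    pose m := Num.min d (r / 2 / M).
    have m0 : 0 < m by rewrite lt_min d0 !divr_gt0.
    have [t St] := sup_adherent m0 hs.
    rewrite -/u => ut.
    have tu : t <= u by apply: ub_le_sup => //; case: hs.
    have [/andP[t0 _] ft] := St.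
    have md : m <= d by rewrite ge_min lexx.
    have mr : m * M <= r / 2 by rewrite -ler_pdivlMr// ge_min lexx orbT.
    have futd : f u - f t < r / 2 by apply: fcd; rewrite ?t0//; lra.
    have := ler_wpM2r (ltW M0) (ltW ut).
    move: ft futd mr cM tu; nra.
  have [ub'|] := ltP u b; last first.
    by move=> bu; have -> : b = u by [apply/eqP; rewrite eq_le ub bu]; case: uS.
  have [d d0 fdd] := fd u (introT andP (conj u0 ub')) _ e0.
  pose h := Num.min (d / 2) (b - u).
  have h0 : 0 < h by rewrite lt_min divr_gt0//= subr_gt0.
  have hd : h < d.
    by apply: (@le_lt_trans _ _ (d / 2)); [rewrite ge_min lexx|lra].
  have hb : h <= b - u by rewrite ge_min lexx orbT.
  have : S (u + h).
    split; first by apply/andP; split; lra.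
    have [_ fu] := uS.
    have := fdd h (introT andP (conj h0 hd)).
    rewrite (mulrDr (c + e) u h); lra.
  move=> /(ub_le_sup _) -/(_ (proj2 hs)); rewrite -/u; lra.
rewrite -subr_ge0; apply/ler_addgt0Pr => r r0.
have k0 : 0 < b + 1 by lra.
have := key (r / (b + 1)) (divr_gt0 r0 k0).
have : r / (b + 1) * b <= r.
  by rewrite mulrAC ler_pdivrMr// ler_pM2l//; lra.
rewrite mulrDl; lra.
Qed.

(** Cluster points replace convergent subsequences throughout: it is enough that
    the sequence is close to [p] at arbitrarily late indices. *)
Lemma compact_seq (X : topologicalType) (K : set X) (u : nat -> X) :
  compact K -> (forall n, K (u n)) ->
  exists2 p, K p & forall V, nbhs p V -> forall N, exists2 n, (N <= n)%N & V (u n).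
Proof.
move=> cK Ku; have [] := cK (u @ \oo) _.
  by exists 0%N => // n _; exact: Ku.
move=> p [Kp clp]; exists p => // V pV N.
have [|y [[n /= nN <-] Vy]] := clp [set y | exists2 n, (N <= n)%N & u n = y] V _ pV.
  by exists N => // n /= nN; exists n.
by exists n.
Qed.

Section Semigroup.
Context (R : realType) (H : hilbertType R).
Variable T : R -> {linear H -> H}.
Implicit Types (x y : H) (s t : R).

Section C0.
Hypothesis C0 : C0_semigroup T.

Lemma C0_bounded t : 0 <= t ->
  exists2 M : R, 0 < M & forall x, rnorm (T t x) <= M * rnorm x.
Proof. by move=> t0; apply/bounded_opP/(semigroup_bounded C0). Qed.

Lemma C0_comm s t x : 0 <= s -> 0 <= t -> T s (T t x) = T t (T s x).
Proof. by move=> s0 t0; rewrite -!(semigroupD C0)// addrC. Qed.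

Lemma C0_cont x t : 0 <= t -> forall e : R, 0 < e -> exists2 d : R, 0 < d &
  forall s : R, 0 <= s -> t - d < s < t + d -> rnorm (T s x - T t x) < e.
Proof.
move=> t0 e e0.
have /(_ t) := @semigroup_continuous _ _ _ C0 x.
rewrite /continuous_at /= => /cvgrPdist_lt /(_ e%:C%C).
rewrite ltcR => /(_ e0).
rewrite /prop_near1 /nbhs /= /nbhs_subspace mem_set//= /within /=.
move=> [d /= d0 hd]; exists d => // s s0 st.
have := hd s; rewrite /ball_ /= ltr_distlC => /(_ st s0).
by rewrite rnormE ltcR rnormB.
Qed.

Lemma C0_cont_left x t (e : R) : 0 <= t -> 0 < e -> exists2 d : R, 0 < d &
  forall s, 0 <= s <= t -> t - d < s -> rnorm (T t x - T s x) < e.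
Proof.
move=> t0 e0; have [d d0 hd] := C0_cont x t0 e0.
exists d => // s /andP[s0 st] sd; rewrite rnormB hd// sd; lra.
Qed.

Lemma C0_cont0 x (e : R) : 0 < e -> exists2 d : R, 0 < d &
  forall s, 0 <= s -> s <= d -> rnorm (T s x - x) <= e.
Proof.
move=> e0; have [d d0 hd] := C0_cont x (lexx 0) e0.
exists (d / 2) => [|s s0 sd]; first by rewrite divr_gt0.
rewrite -[X in _ - X](semigroup0 C0) ltW// hd// ?sub0r ?add0r.
by apply/andP; split; lra.
Qed.

Lemma C0_unif_cont x (a e : R) : 0 <= a -> 0 < e -> exists2 d : R, 0 < d &
  forall s t, 0 <= s -> s <= t -> t <= a -> t - s < d ->
    rnorm (T t x - T s x) < e.
Proof.
move=> a0 e0; apply: contrapT => nd.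
(* Otherwise some pairs of times get closer and closer without their values doing
   so; this contradicts continuity at a cluster point of the first times. *)
have /choice[st hst] : forall n : nat, exists st : R * R,
    [/\ 0 <= st.1, st.1 <= st.2, st.2 <= a, st.2 - st.1 < n.+1%:R^-1 &
        e <= rnorm (T st.2 x - T st.1 x)].
  move=> n; apply: contrapT => nst; apply: nd.
  exists (n.+1%:R^-1) => [|s t s0 sa ta st]; first by rewrite invr_gt0.
  by rewrite ltNge; apply/negP => le; apply: nst; exists (s, t).
have [p pK clp] : exists2 p : R, `[0, a]%classic p & forall V, nbhs p V ->
    forall N, exists2 n, (N <= n)%N & V (st n).1.
  apply: (compact_seq (u := fun n => (st n).1)) => [|n].
    exact: segment_compact.
  have [s0 st' ta _ _] := hst n.
  by rewrite /= in_itv /= s0 (le_trans st').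
have p0 : 0 <= p by move: pK; rewrite /= in_itv => /andP[].
have [d d0 hd] := C0_cont x p0 (divr_gt0 e0 (ltr0n R 2)).
have d20 : 0 < d / 2 by rewrite divr_gt0.
have [N _ hN] := near_infty_natSinv_lt (PosNum d20).
have [|n Nn sp] := clp [set t : R | p - d / 2 < t < p + d / 2] _ N.
  by exists (d / 2) => //= t /=; rewrite /ball_ /= ltr_distlC.
have [s0 st' ta dst le] := hst n.
have {}dst := lt_trans dst (hN n Nn); rewrite /= in sp dst; case/andP: sp => sp1 sp2.
have h1 : rnorm (T (st n).1 x - T p x) < e / 2.
  by apply: hd => //; apply/andP; split; lra.
have h2 : rnorm (T (st n).2 x - T p x) < e / 2.
  by apply: hd; [lra|apply/andP; split; lra].
have := rnorm_trans (T p x) (T (st n).2 x) (T (st n).1 x).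
rewrite (rnormB (T p x)); move: le h1 h2; lra.
Qed.

End C0.

Section Generator.
Variable A : lin_op H H.
Hypothesis gen : is_generator T A.

(** The difference quotient multiplied out, so that no inverse remains. *)
Lemma generatorP x y : (op_dom A x /\ A x = y) <->
  (forall e : R, 0 < e -> exists2 d : R, 0 < d & forall h : R, 0 < h < d ->
     rnorm (T h x - x - rsc h y) <= e * h).
Proof.
have eqn (h : R) : 0 < h ->
    rnorm (T h x - x - rsc h y) = h * rnorm (y - (h^-1)%:C%C *: (T h x - x)).
  move=> h0; rewrite -rnormZ ?ltW// rscBr -/(rsc _ _) rscA.
  by rewrite mulfV ?gt_eqF// rsc1 rnormB.
split=> [/gen /cvgrPdist_le cv e e0|h].
  have := cv e%:C%C; rewrite ltcR => /(_ e0).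
  move=> [d /= d0 hd]; exists d => // h /andP[h0 hlt].
  rewrite eqn// mulrC ler_pM2r//.
  have := hd h; rewrite /ball_ /= sub0r normrN gtr0_norm// => /(_ hlt h0).
  by rewrite rnormE lecR.
apply/gen/cvgrPdist_le => z z0.
have /complex_realP[e ze] := gtr0_real z0.
have e0 : 0 < e by rewrite -ltcR -ze.
have [d d0 hd] := h e e0.
exists d => //= t; rewrite /ball_ /= sub0r normrN => td t0.
rewrite gtr0_norm// in td.
have := hd t (introT andP (conj t0 td)).
by rewrite eqn// mulrC ler_pM2r// rnormE ze lecR.
Qed.

Lemma generator_right_deriv x : op_dom A x ->
  (forall e : R, 0 < e -> exists2 d : R, 0 < d & forall h : R, 0 < h < d ->
     rnorm (T h x - x - rsc h (A x)) <= e * h).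
Proof. by move=> dx; apply/generatorP. Qed.

Hypothesis C0 : C0_semigroup T.

Lemma generator_invariant t x : 0 <= t -> op_dom A x ->
  op_dom A (T t x) /\ A (T t x) = T t (A x).
Proof.
move=> t0 dx; apply/generatorP => e e0.
have [M M0 TM] := C0_bounded C0 t0.
have [d d0 hd] := generator_right_deriv dx (divr_gt0 e0 M0).
exists d => // h /andP[h0 hlt].
rewrite (C0_comm C0 _ (ltW h0) t0) -linear_rsc -!linearB.
apply: (le_trans (TM _)).
rewrite mulrC -ler_pdivlMr// mulrAC.
by apply: hd; rewrite h0.
Qed.

End Generator.
End Semigroup.

Lemma small_dyadic (R : realType) (l d : R) : 0 <= l -> 0 < d ->
  exists N, l / 2 ^+ N < d.
Proof.
move=> l0 d0; have k0 : 0 < d / (l + 1) by rewrite divr_gt0//; lra.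
have [N _ hN] := near_infty_natSinv_expn_lt (PosNum k0).
exists N; have := hN N (leqnn N); rewrite /= ltr_pdivlMr; last lra.
rewrite mulrC div1r mulrDl mul1r => h; apply: lt_trans h.
by rewrite ltrDl invr_gt0 exprn_gt0.
Qed.

Section Limits.
Context (R : realType) (H : hilbertType R).

Lemma rnorm_cvgP (u : nat -> H) (l : H) : (u n @[n --> \oo] --> l) <->
  (forall e : R, 0 < e -> exists N, forall n, (N <= n)%N -> rnorm (u n - l) <= e).
Proof.
split=> [/cvgrPdist_le cv e e0|cv].
  have := cv e%:C%C; rewrite ltcR => /(_ e0) [N _ hN].
  exists N => n Nn; have := hN n Nn.
  by rewrite /= rnormE lecR rnormB.
apply/cvgrPdist_le => z z0.
have /complex_realP[e ze] := gtr0_real z0.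
have e0 : 0 < e by rewrite -ltcR -ze.
have [N hN] := cv e e0.
by exists N => // n Nn /=; rewrite rnormE ze lecR rnormB; exact: hN.
Qed.

Lemma rnorm_complete (u : nat -> H) :
  (forall e : R, 0 < e -> exists N, forall m, rnorm (u (N + m)%N - u N) <= e) ->
  exists l : H, u n @[n --> \oo] --> l.
Proof.
move=> uc; suff cu : cauchy (u @ \oo) by exists (lim (u @ \oo)); exact: cauchy_cvg.
apply/cauchy_ballP => z z0.
have /complex_realP[e ze] := gtr0_real z0.
have e0 : 0 < e by rewrite -ltcR -ze.
have e30 : 0 < e / 3 by rewrite divr_gt0.
have [N hN] := uc _ e30.
pose B := [set u n | n in [set n | (N <= n)%N]].
have BN : (u n @[n --> \oo]) B by exists N => // n Nn /=; exists n.
exists (B, B) => // -[_ _] [/= [n Nn <-] [m Nm <-]].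
rewrite -ball_normE /ball_ /= rnormE ze ltcR.
have := rnorm_trans (u N) (u n) (u m); rewrite (rnormB (u N) (u m)).
have := hN (n - N)%N; have := hN (m - N)%N; rewrite !subnKC//; lra.
Qed.

Lemma rnorm_cvg_le (u : nat -> H) (l y : H) (e : R) :
  u n @[n --> \oo] --> l -> (forall n, rnorm (u n - y) <= e) ->
  rnorm (l - y) <= e.
Proof.
move=> /rnorm_cvgP cv h; apply/ler_addgt0Pr => r r0.
have [N /(_ N (leqnn N)) hN] := cv r r0.
have := rnorm_trans (u N) l y; rewrite (rnormB l (u N)).
by have := h N; move: hN; lra.
Qed.

End Limits.

(** * Density of the domain of a generator *)

(** The left Riemann sum of [f] over [[s, s + l]] with [2 ^ n] equal pieces,
    divided by [l]. The recursion halves the interval, so that both refinement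
    and translation are immediate. *)
Fixpoint dyadic_mean (R : realType) (H : hilbertType R) (f : R -> H) (n : nat)
    (s l : R) : H :=
  if n is m.+1 then
    rsc 2^-1 (dyadic_mean f m s (l / 2) + dyadic_mean f m (s + l / 2) (l / 2))
  else f s.

Section DyadicMean.
Context (R : realType) (H : hilbertType R).
Implicit Types (f : R -> H) (s l e : R).

Lemma rnorm_half (x y z w : H) e : rnorm (x - z) <= e -> rnorm (y - w) <= e ->
  rnorm (rsc 2^-1 (x + y) - rsc 2^-1 (z + w)) <= e.
Proof.
move=> xz yw; rewrite -rscBr rnormZ ?invr_ge0// opprD addrACA.
by have := rnormD (x - z) (y - w); lra.
Qed.

Lemma rsc_half (x : H) : rsc 2^-1 (x + x) = x.
Proof. by rewrite rscDr -rscDl -[RHS]rsc1; congr rsc; field. Qed.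

Lemma dyadic_mean_near f n s l e y : 0 <= l ->
  (forall u, s <= u -> u <= s + l -> rnorm (f u - y) <= e) ->
  rnorm (dyadic_mean f n s l - y) <= e.
Proof.
elim: n s l => [|n IH] s l l0 h /=; first by apply: h => //; lra.
rewrite -[y]rsc_half; apply: rnorm_half; apply: IH; first lra.
- by move=> u su us; apply: h; lra.
- lra.
- by move=> u su us; apply: h; lra.
Qed.

Lemma dyadic_mean_refine f n m s l e : 0 <= l ->
  (forall u v, s <= u -> u <= v -> v <= s + l -> v - u <= l / 2 ^+ n ->
     rnorm (f v - f u) <= e) ->
  rnorm (dyadic_mean f (n + m) s l - dyadic_mean f n s l) <= e.
Proof.
elim: n s l => [|n IH] s l l0 h /=.
  by apply: dyadic_mean_near => // u su us; apply: h => //; lra.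
have eqh : l / 2 / 2 ^+ n = l / 2 ^+ n.+1 by rewrite exprS invfM mulrA.
apply: rnorm_half; apply: IH; rewrite ?eqh; try lra.
- by move=> u v su uv vs; apply: h => //; lra.
- by move=> u v su uv vs; apply: h => //; lra.
Qed.

End DyadicMean.

Section Density.
Context (R : realType) (H : hilbertType R).
Variables (T : R -> {linear H -> H}) (A : lin_op H H).
Hypotheses (C0 : C0_semigroup T) (gen : is_generator T A).

Local Notation mean x := (dyadic_mean (fun t => T t x)).

Lemma dyadic_mean_shift x n t s l : 0 <= t -> 0 <= s -> 0 <= l ->
  T t (mean x n s l) = mean x n (t + s) l.
Proof.
move=> t0; elim: n s l => [|n IH] s l s0 l0 /=; first by rewrite -semigroupD.
rewrite linear_rsc linearD !IH ?addrA//; lra.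
Qed.

Lemma C0_cvg t (u : nat -> H) l : 0 <= t ->
  u n @[n --> \oo] --> l -> T t (u n) @[n --> \oo] --> T t l.
Proof.
move=> t0 /rnorm_cvgP cv; apply/rnorm_cvgP => e e0.
have [M M0 TM] := C0_bounded C0 t0.
have [N hN] := cv _ (divr_gt0 e0 M0); exists N => n Nn.
rewrite -linearB (le_trans (TM _))// mulrC -ler_pdivlMr//; exact: hN.
Qed.

Lemma dyadic_mean_cvg x l : 0 <= l -> exists y : H, mean x n 0 l @[n --> \oo] --> y.
Proof.
move=> l0; apply: rnorm_complete => e e0.
have [d d0 hd] := C0_unif_cont C0 x l0 e0.
have [N hN] := small_dyadic l0 d0.
exists N => m; apply: dyadic_mean_refine => // u v u0 uv vl vu.
by apply: ltW; apply: hd => //; lra.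
Qed.

Section OrbitMean.
Variables (x : H) (J : R -> H).
Hypothesis J_lim : forall l, 0 <= l -> mean x n 0 l @[n --> \oo] --> J l.

Lemma orbit_mean_near t l y e : 0 <= t -> 0 <= l ->
  (forall u, t <= u -> u <= t + l -> rnorm (T u x - y) <= e) ->
  rnorm (T t (J l) - y) <= e.
Proof.
move=> t0 l0 h.
apply: rnorm_cvg_le (C0_cvg t0 (J_lim l0)) _ => n.
by rewrite dyadic_mean_shift// addr0; apply: dyadic_mean_near.
Qed.

Lemma orbit_mean_half l : 0 <= l ->
  J l = rsc 2^-1 (J (l / 2) + T (l / 2) (J (l / 2))).
Proof.
move=> l0; have l20 : 0 <= l / 2 by lra.
have := J_lim l0; rewrite -cvg_shiftS /= => J1.
apply: (norm_cvg_unique J1).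
have -> : (fun n => rsc 2^-1 (mean x n 0 (l / 2) + mean x n (0 + l / 2) (l / 2))) =
    (fun n => rsc 2^-1 (mean x n 0 (l / 2) + T (l / 2) (mean x n 0 (l / 2)))).
  by apply/funext => n; rewrite dyadic_mean_shift// add0r addr0.
apply: cvgZr; apply: cvgD; [exact: J_lim|].
by apply: C0_cvg => //; exact: J_lim.
Qed.

(** Up to normalisation, the integral over [[r, l + r]] minus the one over
    [[0, l]] is the integral over [[l, l + r]] minus the one over [[0, r]]. *)
Lemma orbit_mean_incr m l : 0 <= l -> let r := l / 2 ^+ m in
  T r (J l) - J l = rsc (2 ^+ m)^-1 (T l (J r) - J r).
Proof.
move=> l0 /=; elim: m l l0 => [|m IH] l l0; first by rewrite expr0 invr1 mulr1 rsc1.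
have l20 : 0 <= l / 2 by lra.
have := IH _ l20; set r := l / 2 / 2 ^+ m.
have -> : l / 2 ^+ m.+1 = r by rewrite /r exprS invfM mulrA.
have r0 : 0 <= r by rewrite divr_ge0// exprn_ge0.
move=> E; rewrite (orbit_mean_half l0) linear_rsc -rscBr linearD.
rewrite (C0_comm C0)// opprD addrACA -linearB E linear_rsc linearB.
rewrite -(semigroupD C0)// -mulrDl -rscDr addrC addrA subrK rscA.
by rewrite exprS invfM; congr (rsc _ (T _ _ - _)); field.
Qed.

End OrbitMean.

(** The mean [J l] of the orbit of [x] over [[0, l]] lies in the domain: an
    increment of its orbit is the difference of the integrals over two short
    intervals, starting at [l] and at [0]. For increments of dyadic length this
    is [orbit_mean_incr]; sums of such increments and continuity give the
    others. For short [l] the mean is close to [x]. *)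
Lemma generator_dense x e : 0 < e -> exists2 y, op_dom A y & rnorm (y - x) <= e.
Proof.
move=> e0.
have /choice[J J_lim] : forall l : R, exists y : H,
    0 <= l -> mean x n 0 l @[n --> \oo] --> y.
  move=> l; have [l0|_] := leP 0 l; last by exists 0.
  by have [y hy] := dyadic_mean_cvg x l0; exists y.
have [a a0 ha] := C0_cont0 C0 x e0.
exists (J a); last first.
  rewrite -(semigroup0 C0 (J a)).
  by apply: (orbit_mean_near J_lim) => // [|u u0]; [exact: ltW|rewrite add0r; exact: ha].
suff [] : op_dom A (J a) /\ A (J a) = rsc a^-1 (T a x - x) by [].
apply/(generatorP gen) => r r0.
have [C C1 TC] := C0_bounded C0 (ltW a0).
have CC0 : 0 < C + 1 by lra.
pose eta := r * a / (C + 1).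
have eta0 : 0 < eta by rewrite !(mulr_gt0, invr_gt0).
have [d d0 hd] := C0_cont0 C0 x eta0.
(* The error is at most [C + 1] times the oscillation of the orbit of [x] on
   [[0, d]], per unit of time and relative to [a]; hence the choice of [eta]. *)
have grid m j : let h := a / 2 ^+ m in j%:R * h <= d ->
    rnorm (T (j%:R * h) (J a) - J a - rsc (j%:R * h) (rsc a^-1 (T a x - x)))
      <= r * (j%:R * h).
  move=> h; elim: j => [|j IH] jd.
    by rewrite mul0r semigroup0// rsc0l subrr subr0 rnorm0 mulr0.
  have h0 : 0 <= h by rewrite divr_ge0 ?exprn_ge0// ltW.
  have jh0 : 0 <= j%:R * h by rewrite mulr_ge0.
  have eqj : j.+1%:R * h = j%:R * h + h by rewrite -natr1 mulrDl mul1r.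
  have {}IH := IH (ltac:(by move: jd; rewrite eqj; lra)).
  have := orbit_mean_incr J_lim m (ltW a0); rewrite -/h /= => E.
  have -> : T (j.+1%:R * h) (J a) - J a - rsc (j.+1%:R * h) (rsc a^-1 (T a x - x))
      = (T (j%:R * h) (J a) - J a - rsc (j%:R * h) (rsc a^-1 (T a x - x))) +
        rsc (2 ^+ m)^-1 (T a (T (j%:R * h) (J h) - x) - (T (j%:R * h) (J h) - x)).
    have -> : T a (T (j%:R * h) (J h) - x) - (T (j%:R * h) (J h) - x) =
       T (j%:R * h) (T a (J h) - J h) - (T a x - x).
      by rewrite (linearB (T a)) (linearB (T _)) (C0_comm C0 _ (ltW a0) jh0) subrACA.
    rewrite (rscBr (2 ^+ m)^-1) -linear_rsc -E (linearB (T _)) -(semigroupD C0)// -eqj.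
    rewrite eqj rscDl (rscA h).
    have -> : h * a^-1 = (2 ^+ m)^-1 by rewrite /h mulrC mulKf// gt_eqF.
    exact: subr_telescope.
  rewrite eqj mulrDr; apply: (le_trans (rnormD _ _)); apply: lerD => //.
  rewrite rnormZ ?invr_ge0 ?exprn_ge0//.
  set z := T _ (J h) - x.
  have zeta : rnorm z <= eta.
    apply: (orbit_mean_near J_lim) => // u u0 us; apply: hd; first lra.
    by rewrite (le_trans us)// -eqj.
  have -> : r * h = (2 ^+ m)^-1 * ((C + 1) * eta).
    by rewrite /h /eta; field; rewrite expf_neq0//= gt_eqF.
  rewrite ler_pM2l ?invr_gt0 ?exprn_gt0//.
  apply: (le_trans (rnormD _ _)); rewrite rnormN.
  have := TC z; have := rnorm_ge0 z; nra.
(* An arbitrary [h] is rounded down to a multiple of [a / 2 ^+ m]. *)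
exists d => // h /andP[h0 hlt].
apply/ler_addgt0Pr => k k0.
set w := rsc a^-1 (T a x - x).
have k30 : 0 < k / 3 by rewrite divr_gt0.
have [d1 d10 hd1] := C0_cont C0 (J a) (ltW h0) k30.
have w0 := rnorm_ge0 w.
pose d2 := Num.min d1 (k / 3 / (rnorm w + 1)).
have w1 : 0 < rnorm w + 1 by lra.
have d20 : 0 < d2 by rewrite lt_min d10 divr_gt0.
have d21 : d2 <= d1 by rewrite ge_min lexx.
have d2w : d2 * (rnorm w + 1) <= k / 3 by rewrite -ler_pdivlMr// ge_min lexx orbT.
have [m hm] := small_dyadic (ltW a0) d20.
have q0 : 0 < a / 2 ^+ m by rewrite divr_gt0// exprn_gt0.
pose j := Num.truncn (h / (a / 2 ^+ m)).
have /andP[j1 j2] := truncn_itv (ltW (divr_gt0 h0 q0)).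
have {}j1 : j%:R * (a / 2 ^+ m) <= h by rewrite -ler_pdivlMr.
have {}j2 : h < j%:R * (a / 2 ^+ m) + a / 2 ^+ m.
  by move: j2; rewrite ltr_pdivrMr// -natr1 mulrDl mul1r.
have := grid m j (le_trans j1 (ltW hlt)); rewrite -/w.
set t := j%:R * _ in j1 j2 *.
have t0 : 0 <= t by rewrite mulr_ge0// ltW.
move=> gr.
have Tt : rnorm (T h (J a) - T t (J a)) < k / 3.
  by rewrite rnormB; apply: hd1 => //; apply/andP; split; lra.
rewrite -[in rsc h w](subrKC t h) rscDl (subr_telescope _ (T t (J a))).
apply: (le_trans (rnormD _ _)).
have := rnormD (T h (J a) - T t (J a)) (- rsc (h - t) w).
rewrite rnormN rnormZ ?subr_ge0//.
have : (h - t) * rnorm w <= k / 3.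
  apply: le_trans d2w; apply: ler_pM => //; lra.
have : r * t <= r * h by rewrite ler_pM2l.
by move: gr Tt; lra.
Qed.

End Density.

(** * Contraction semigroups *)

Section Contraction.
Context (R : realType) (H : hilbertType R).

Definition nonexpansive (U : H -> H) := forall x, rnorm (U x) <= rnorm x.

Lemma unit_ball_scale (x : H) (M : R) (N : H -> R) :
  (forall r y, 0 <= r -> N (rsc r y) = r * N y) ->
  (forall y, rnorm y <= 1 -> N y <= M) -> N x <= M * rnorm x.
Proof.
move=> NZ h; have [x0|x0] := eqVneq (rnorm x) 0.
  by rewrite x0 mulr0 (rnorm0_eq0 x0) -(rsc0l 0) NZ// mul0r.
have xp : 0 < rnorm x by rewrite lt0r x0 rnorm_ge0.
rewrite -ler_pdivrMr// mulrC -NZ ?invr_ge0 ?rnorm_ge0//.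
by apply: h; rewrite rnormZ ?invr_ge0 ?rnorm_ge0// mulVf.
Qed.

Lemma op_norm_le1P (U : {linear H -> H}) : (op_norm U <= 1)%E -> nonexpansive U.
Proof.
move=> U1 x; rewrite -[leRHS]mul1r.
apply: (@unit_ball_scale x 1 (fun z => rnorm (U z))) => [r y r0|y y1].
  by rewrite linear_rsc rnormZ.
rewrite -lee_fin; apply: le_trans U1.
by apply: ereal_sup_ubound; exists y.
Qed.

(** That is, the adjoint of a contraction fixes the same vectors. Compare the
    norms of [y + e x] and of its image for small [e] of either sign. *)
Lemma nonexpansive_fixed (U : {linear H -> H}) (x y : H) :
  nonexpansive U -> U y = y -> rip (U x) y = rip x y.
Proof.
move=> cU Uy; apply/eqP; rewrite -subr_eq0; apply/eqP.
set d := _ - _; set k := rnorm x ^+ 2 - rnorm (U x) ^+ 2.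
have k0 : 0 <= k by rewrite subr_ge0 ler_sqr ?nnegrE ?rnorm_ge0.
have h (e : R) : 2 * e * d <= e ^+ 2 * k.
  have := cU (y + rsc e x); rewrite linearD Uy linear_rsc.
  rewrite -ler_sqr ?nnegrE ?rnorm_ge0// !sqnormD !ripZr -!ripxx !ripZl !ripZr !ripxx.
  by rewrite /d /k (ripC _ y) (ripC x); lra.
(* At [e = d / (k + 1)] the bound fails unless [d] vanishes. *)
have k1 : k + 1 != 0 by rewrite gt_eqF//; lra.
have := h (d / (k + 1)).
have -> : 2 * (d / (k + 1)) * d = d ^+ 2 * (2 * (k + 1)) / (k + 1) ^+ 2 by field.
have -> : (d / (k + 1)) ^+ 2 * k = d ^+ 2 * k / (k + 1) ^+ 2 by field.
rewrite ler_pM2r ?invr_gt0 ?exprn_gt0//; last lra.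
move=> hd; apply/eqP; rewrite -sqrf_eq0 eq_le sqr_ge0 andbT.
have := sqr_ge0 d; nra.
Qed.

End Contraction.

Section Generator.
Context (R : realType) (H : hilbertType R).
Variables (T : R -> {linear H -> H}) (A : lin_op H H).
Hypotheses (C0 : C0_semigroup T) (gen : is_generator T A).

(** Apply the mean value inequality to the component of the orbit along the
    vector to be estimated. *)
Lemma orbit_increment x y t K : 0 <= t -> op_dom A x ->
  (forall s, 0 <= s -> s <= t -> rnorm (T s (A x) - y) <= K) ->
  rnorm (T t x - x - rsc t y) <= K * t.
Proof.
move=> t0 dx hK; set v := T t x - x - rsc t y.
have K0 : 0 <= K by apply: le_trans (hK 0 _ _) => //; exact: rnorm_ge0.
have [v0|v0] := eqVneq (rnorm v) 0; first by rewrite v0 mulr_ge0.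
have vp : 0 < rnorm v by rewrite lt0r v0 rnorm_ge0.
pose f s := rip (T s x - rsc s y) v.
suff : f t - f 0 <= (K * rnorm v) * t.
  rewrite /f -ripBl (semigroup0 C0) rsc0l subr0 addrAC -/v ripxx expr2.
  by rewrite mulrAC ler_pM2r.
have fE s u : f s - f u = rip (T s x - T u x) v - (s - u) * rip y v.
  by rewrite /f -ripBl subrACA -rscBl ripBl ripZl.
apply: right_derivative_le => // [s /andP[s0 st] e e0|s /andP[s0 st] e e0].
  have q0 : 0 < e / 2 / rnorm v by rewrite !divr_gt0.
  have [d d0 hd] := C0_cont_left C0 x s0 q0.
  have [Y Y0 hY] : exists2 Y : R, 0 < Y & - rip y v <= Y.
    exists (`|rip y v| + 1); first by rewrite ltr_wpDl.
    by rewrite -normrN (le_trans (ler_norm _))// lerDl.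
  exists (Num.min d (e / 2 / Y)) => [|u us]; first by rewrite lt_min d0 !divr_gt0.
  move=> su; rewrite fE.
  have md : Num.min d (e / 2 / Y) <= d by rewrite ge_min lexx.
  have mY : Num.min d (e / 2 / Y) * Y <= e / 2.
    by rewrite -ler_pdivlMr// ge_min lexx orbT.
  have h1 : rip (T s x - T u x) v < e / 2.
    apply: (le_lt_trans (rip_le _ _)); rewrite -ltr_pdivlMr//.
    by apply: hd => //; lra.
  have {}us : 0 <= s - u by case/andP: us; lra.
  have : (s - u) * - rip y v <= e / 2.
    apply: le_trans mY; apply: (@le_trans _ _ ((s - u) * Y)).
      by rewrite ler_wpM2l.
    by rewrite ler_pM2r//; lra.
  by rewrite mulrN; lra.
have [dT AT] := generator_invariant gen C0 s0 dx.
have q0 : 0 < e / rnorm v by rewrite divr_gt0.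
have [d d0 hd] := generator_right_deriv gen dT q0.
exists d => // h hlt; have := hd h hlt; have /andP[h0 _] := hlt.
rewrite fE (addrC s h) addrK (semigroupD C0 _ (ltW h0) s0) AT => hh.
have -> : rip (T h (T s x) - T s x) v - h * rip y v =
    rip (T h (T s x) - T s x - rsc h (T s (A x))) v + h * rip (T s (A x) - y) v.
  by rewrite !ripBl ripZl; ring.
have /le_trans h1 := rip_le (T h (T s x) - T s x - rsc h (T s (A x))) v.
have {}h1 := h1 _ (ler_wpM2r (ltW vp) hh).
have h2 : rip (T s (A x) - y) v <= K * rnorm v.
  apply: (le_trans (rip_le _ _)); rewrite ler_pM2r//; apply: hK => //; exact: ltW.
have h3 : h * rip (T s (A x) - y) v <= h * (K * rnorm v) by rewrite ler_pM2l.
have e1 : e / rnorm v * h * rnorm v = e * h by field.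
by move: h1 h3; rewrite e1; lra.
Qed.

Lemma kernel_fixed x t : 0 <= t -> op_dom A x -> A x = 0 -> T t x = x.
Proof.
move=> t0 dx Ax; apply/eqP; rewrite -subr_eq0; apply/eqP/rnorm0_eq0/eqP.
rewrite eq_le rnorm_ge0 andbT.
have := @orbit_increment x 0 t 0 t0 dx; rewrite mul0r /rsc scaler0 subr0; apply.
by move=> s _ _; rewrite Ax linear0 subr0 rnorm0.
Qed.

Lemma fixed_kernel x : (forall t, 0 <= t -> T t x = x) ->
  op_dom A x /\ A x = 0.
Proof.
move=> fx; apply/(generatorP gen) => e e0; exists 1 => // h /andP[h0 _].
by rewrite (fx _ (ltW h0)) subrr /rsc scaler0 subr0 rnorm0 mulr_ge0// ltW.
Qed.

(** The squared norm has right derivative [2 * rip (A u) u] along the orbit. The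
    factor [sg] is there to bound its growth as well as its decay. *)
Lemma energy_le (sg c : R) x t : -1 <= sg <= 1 -> 0 <= t -> op_dom A x ->
  (forall s, 0 <= s -> s < t -> sg * (2 * rip (A (T s x)) (T s x)) <= c) ->
  sg * rnorm (T t x) ^+ 2 - sg * rnorm x ^+ 2 <= c * t.
Proof.
move=> sg1 t0 dx hc.
have sgE (a b : R) : - b <= a <= b -> sg * a <= b.
  case/andP: sg1 => ? ? /andP[? ?]; nra.
pose f s := sg * rnorm (T s x) ^+ 2.
suff : f t - f 0 <= c * t by rewrite /f (semigroup0 C0).
apply: right_derivative_le => // [s /andP[s0 st] e e0|s /andP[s0 st] e e0].
  set a := rnorm (T s x).
  have a0 : 0 <= a by exact: rnorm_ge0.
  have a1 : 0 < 2 * a + 1 by lra.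
  pose m := Num.min 1 (e / (2 * a + 1)).
  have m0 : 0 < m by rewrite lt_min ltr01 divr_gt0.
  have m1 : m <= 1 by rewrite ge_min lexx.
  have me : m * (2 * a + 1) <= e by rewrite -ler_pdivlMr// ge_min lexx orbT.
  have [d d0 hd] := C0_cont_left C0 x s0 m0.
  exists d => // u us su; rewrite /f -mulrBr -/a.
  have hu := hd u us su.
  have u0 := rnorm_ge0 (T u x).
  have n1 : a <= rnorm (T s x - T u x) + rnorm (T u x).
    by have := rnormD (T s x - T u x) (T u x); rewrite subrK.
  have n2 : rnorm (T u x) <= rnorm (T s x - T u x) + a.
    by have := rnormD (T u x - T s x) (T s x); rewrite subrK (rnormB (T u x)).
  apply: (@le_lt_trans _ _ (rnorm (T s x - T u x) * (2 * a + m))).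
    have z0 := rnorm_ge0 (T s x - T u x).
    by apply: sgE; apply/andP; split; nra.
  apply: (@lt_le_trans _ _ (m * (2 * a + m))); last nra.
  by rewrite ltr_pM2r//; lra.
have [dT _] := generator_invariant gen C0 s0 dx.
set u := T s x in dT *; set w := A u.
have u0 := rnorm_ge0 u; have w0 := rnorm_ge0 w.
have u1 : 0 < 2 * rnorm u + 1 by lra.
pose eta := e / 2 / (2 * rnorm u + 1).
have eta0 : 0 < eta by rewrite !divr_gt0.
have etau : 2 * rnorm u * eta <= e / 2.
  rewrite /eta mulrA ler_pdivrMr//; nra.
have [d d0 hd] := generator_right_deriv gen dT eta0.
have k0 : 0 < (rnorm w + eta) ^+ 2 by rewrite exprn_gt0// ltr_wpDl.
pose m := Num.min d (e / 2 / (rnorm w + eta) ^+ 2).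
exists m => [|h /andP[h0 hm]]; first by rewrite lt_min d0 !divr_gt0.
have md : m <= d by rewrite ge_min lexx.
have mk : m * (rnorm w + eta) ^+ 2 <= e / 2 by rewrite -ler_pdivlMr// ge_min lexx orbT.
have hlt : 0 < h < d by rewrite h0 (lt_le_trans hm).
rewrite /f (addrC s h) (semigroupD C0 _ (ltW h0) s0) -/u -mulrBr.
have := hd h hlt; rewrite -/w; set r := _ - rsc h w => hr.
have r0 := rnorm_ge0 r.
pose z := rsc h w + r.
have -> : T h u = u + z by rewrite /z /r (addrC (rsc h w)) subrK addrC subrK.
have zn : rnorm z <= h * (rnorm w + eta).
  by apply: (le_trans (rnormD _ _)); rewrite (rnormZ _ (ltW h0)); move: hr; lra.
have z0 := rnorm_ge0 z.
have zn2 : rnorm z ^+ 2 <= h * (e / 2).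
  apply: (@le_trans _ _ ((h * (rnorm w + eta)) ^+ 2)).
    by rewrite ler_sqr ?nnegrE// mulr_ge0 ?ltW// ltr_wpDl.
  rewrite exprMn expr2 -mulrA ler_pM2l//; apply: le_trans mk.
  by rewrite ler_pM2r// ltW.
have -> : sg * (rnorm (u + z) ^+ 2 - rnorm u ^+ 2) =
    h * (sg * (2 * rip w u)) + sg * (2 * rip u r + rnorm z ^+ 2).
  by rewrite sqnormD /z ripDr ripZr (ripC u w); ring.
have c1 : h * (sg * (2 * rip w u)) <= h * c.
  by rewrite ler_pM2l//; exact: hc.
have c2 : sg * (2 * rip u r + rnorm z ^+ 2) <= e * h.
  have b1 := rip_le u r; have b2 := rip_ge u r.
  have b3 : rnorm u * rnorm r <= rnorm u * (eta * h) by rewrite ler_wpM2l.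
  have b4 : 2 * rnorm u * eta * h <= e / 2 * h by rewrite ler_pM2r.
  have b5 := sqr_ge0 (rnorm z).
  by apply: sgE; apply/andP; split; lra.
by rewrite mulrDl; lra.
Qed.

(** On the domain this is the energy estimate; density extends it. *)
Lemma dissipative_nonexpansive :
  (forall x, op_dom A x -> rip (A x) x <= 0) ->
  forall t, 0 <= t -> nonexpansive (T t).
Proof.
move=> diss t t0 x.
have dom y : op_dom A y -> rnorm (T t y) <= rnorm y.
  move=> dy; rewrite -ler_sqr ?nnegrE ?rnorm_ge0//.
  have := @energy_le 1 0 y t _ t0 dy; rewrite !mul1r mul0r subr_le0; apply.
    by apply/andP; split; lra.
  move=> s s0 _; have [dT _] := generator_invariant gen C0 s0 dy.
  by have := diss _ dT; lra.
apply/ler_addgt0Pr => e e0.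
have [M M0 TM] := C0_bounded C0 t0.
have M1 : 0 < M + 1 by lra.
have [y dy xy] := generator_dense C0 gen x (divr_gt0 e0 M1).
have := rnormD (T t x - T t y) (T t y); rewrite subrK.
have := rnormD (y - x) x; rewrite subrK.
have := dom y dy; have := TM (x - y); rewrite (linearB (T t)) (rnormB x).
by move: xy; rewrite ler_pdivlMr//; lra.
Qed.

Hypothesis cT : forall t, 0 <= t -> nonexpansive (T t).

Lemma generator_dissipative x : op_dom A x -> rip (A x) x <= 0.
Proof.
move=> dx; apply/ler_addgt0Pr => e e0; rewrite add0r.
have x1 : 0 < rnorm x + 1 by have := rnorm_ge0 x; lra.
have [d d0 hd] := generator_right_deriv gen dx (divr_gt0 e0 x1).
pose h := d / 2.
have h0 : 0 < h by rewrite divr_gt0.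
have := hd h; rewrite h0 => /(_ _) -/(_ ltac:(rewrite /h; lra)).
set r := _ - _ => hr.
have : rip (T h x - x) x <= 0.
  rewrite ripBl ripxx subr_le0 (le_trans (rip_le _ _))// expr2.
  by rewrite ler_wpM2r ?rnorm_ge0// cT// ltW.
have -> : T h x - x = r + rsc h (A x) by rewrite /r subrK.
rewrite ripDl ripZl => h1.
have h2 := rip_ge r x.
have h3 : rnorm r * rnorm x <= e * h.
  apply: (@le_trans _ _ (rnorm r * (rnorm x + 1))).
    by rewrite ler_wpM2l ?rnorm_ge0// lerDl.
  rewrite -ler_pdivlMr//; apply: (le_trans hr).
  by rewrite mulrAC.
by rewrite -(ler_pM2l h0); lra.
Qed.

(** For [x'] in the domain [T h x' - x'] is the integral of [T s (A x')], hence
    within [e * h] of [h y], for all [h] below a bound that does not depend on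
    [x']; let [x'] tend to [x]. *)
Lemma generator_closed x y :
  (forall e : R, 0 < e -> exists x', [/\ op_dom A x', rnorm (x' - x) <= e &
     rnorm (A x' - y) <= e]) -> op_dom A x /\ A x = y.
Proof.
move=> appr; apply/(generatorP gen) => e e0.
have e20 : 0 < e / 2 by lra.
have [d d0 hd] := C0_cont0 C0 y e20.
exists d => // h /andP[h0 hlt].
apply/ler_addgt0Pr => k k0.
have q0 : 0 < Num.min (e / 2) (k / 2) by rewrite lt_min e20; lra.
have [x' [dx' xx' yy']] := appr _ q0.
have qe : Num.min (e / 2) (k / 2) <= e / 2 by rewrite ge_min lexx.
have qk : Num.min (e / 2) (k / 2) <= k / 2 by rewrite ge_min lexx orbT.
have h1 : rnorm (T h x' - x' - rsc h y) <= e * h.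
  apply: orbit_increment => //; first exact: ltW.
  move=> s s0 sh.
  have := rnorm_trans (T s y) (T s (A x')) y; rewrite -(linearB (T s)).
  have := cT s0 (A x' - y); have := hd s s0 ltac:(lra).
  by move: yy'; lra.
have := rnorm_trans (T h x' - x' - rsc h y) (T h x - x - rsc h y) 0.
rewrite !subr0 (_ : T h x - x - rsc h y - _ = T h (x - x') - (x - x')).
  have := rnormD (T h (x - x')) (- (x - x')); rewrite rnormN.
  by have := cT (ltW h0) (x - x'); move: xx'; rewrite (rnormB x' x); lra.
by rewrite subrACA subrr subr0 subrACA (linearB (T h)).
Qed.

End Generator.

(** * Operator norm convergence and partial operators *)

Section Topology.
Context (R : realType) (H : hilbertType R).

Lemma nbhs_rnorm (p : H) (r : R) : 0 < r -> nbhs p [set z | rnorm (z - p) < r].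
Proof.
move=> r0; apply/nbhs_ballP; exists r%:C%C; first by rewrite /= ltcR.
by move=> z; rewrite -ball_normE /ball_ /= rnormE ltcR rnormB.
Qed.

Lemma op_norm_cvgP (T : R -> {linear H -> H}) (P : {linear H -> H}) :
  op_norm_cvg T P <-> forall e : R, 0 < e -> exists2 t0 : R, 0 <= t0 &
    forall t, t0 <= t -> forall x, rnorm (T t x - P x) <= e * rnorm x.
Proof.
have nge0 t : (0 <= op_norm (T t \- P)%R)%E.
  apply: ereal_sup_ubound; exists 0; rewrite /= ?rnorm0//.
  by rewrite (linear0 (T t)) (linear0 P) subr0 rnorm0.
split=> [cv e e0|h].
  move/fine_cvgP: cv => [fin /cvgrPdist_lt /(_ e e0) cv].
  have [t1 [_ ht]] := filterI fin cv.
  exists (Num.max 0 (t1 + 1)); first by rewrite le_max lexx.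
  move=> t; rewrite ge_max => /andP[t0 t1t] x.
  have {}ht : (op_norm (T t \- P)%R < e%:E)%E.
    have [ft] := ht t ltac:(lra).
    rewrite /= sub0r normrN ger0_norm ?fine_ge0// => hfin.
    by rewrite -(fineK ft) lte_fin.
  apply: (@unit_ball_scale _ _ x e (fun z => rnorm (T t z - P z))) => [r y r0|y y1].
    by rewrite (linear_rsc (T t)) (linear_rsc P) -rscBr rnormZ.
  rewrite -lee_fin; apply: le_trans (ltW ht).
  by apply: ereal_sup_ubound; exists y.
apply/fine_cvgP.
have le t e : (forall x, rnorm (T t x - P x) <= e * rnorm x) -> 0 < e ->
    (op_norm (T t \- P)%R <= e%:E)%E.
  move=> hx e0; apply: ge_ereal_sup => _ [x /= x1 <-]; rewrite lee_fin.
  by apply: (le_trans (hx x)); have := rnorm_ge0 x; nra.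
split.
  have [t0 _ ht] := h 1 ltr01; exists t0; split; first exact: num_real.
  move=> t /ltW /ht /le /(_ ltr01) h1.
  by rewrite ge0_fin_numE// (le_lt_trans h1)// ltry.
apply/cvgrPdist_le => e e0; have [t0 _ ht] := h e e0.
exists t0; split; first exact: num_real.
move=> t /ltW /ht /le /(_ e0) h1 /=.
rewrite sub0r normrN ger0_norm ?fine_ge0// -lee_fin fineK//.
by rewrite ge0_fin_numE// (le_lt_trans h1)// ltry.
Qed.

Lemma rnorm_eq0_le (x : H) (c : R) : 0 < c ->
  (forall e : R, 0 < e -> rnorm x <= e * c) -> x = 0.
Proof.
move=> c0 h; apply/rnorm0_eq0/eqP; rewrite eq_le rnorm_ge0 andbT.
apply/ler_addgt0Pr => e e0; rewrite add0r.
by have := h _ (divr_gt0 e0 c0); rewrite divfK// gt_eqF.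
Qed.

End Topology.

Section OpLinear.
Context (K : pzRingType) (E F : lmodType K) (A : lin_op E F).

Lemma op_domZ a x : op_dom A x -> op_dom A (a *: x).
Proof. by move=> dx; rewrite -[_ *: _]addr0; apply: op_domP => //; exact: op_dom0. Qed.

Lemma op_funD x y : op_dom A x -> op_dom A y -> A (x + y) = A x + A y.
Proof. by move=> dx dy; rewrite -{1}[x]scale1r op_linear// scale1r. Qed.

Lemma op_funZ a x : op_dom A x -> A (a *: x) = a *: A x.
Proof.
move=> dx; rewrite -[a *: x]addr0 op_linear//; last exact: op_dom0.
by rewrite op_fun0 addr0.
Qed.

Lemma op_funB x y : op_dom A x -> op_dom A y -> A (x - y) = A x - A y.
Proof.
move=> dx dy; rewrite -scaleN1r op_funD//; last exact: op_domZ.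
by rewrite op_funZ// scaleN1r.
Qed.

End OpLinear.

(** * The dissipative system *)

Section System.
Context (R : realType) (H1 H2 : hilbertType R).
Variables (A1 : lin_op (hprod H1 H2) H1) (A21 : lin_op H1 H2).
Variable S : {linear H2 -> H2}.
Variables (A11 : lin_op H1 H1) (A12 : lin_op H2 H1).
Hypothesis A1_splits : splitting A1 A11 A12.
Hypothesis A11_everywhere : op_dom A11 = setT.
Hypothesis A11_bounded : bounded_op A11.
Hypothesis Aext_generates : generates_contractive_C0_semigroup (Aext A1 A21).
Hypothesis A21_compact : graph_embeds_compactly A21.
Variable T : R -> {linear H1 -> H1}.
Hypotheses (C0 : C0_semigroup T) (gen : is_generator T (AS A1 A21 S)).
Variable nu : R.
Hypothesis nu0 : 0 < nu.
Hypothesis S_coercive : forall h, nu * rnorm h ^+ 2 <= complex.Re (inner h (S h)).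

Lemma A11_dom x : op_dom A11 x.
Proof. by rewrite A11_everywhere. Qed.

(** The vector [(x, S (A21 x))] lies in the domain of the dissipative operator
    [Aext]; its second component contributes the coercivity of [S]. *)
Lemma AS_dissipative x : op_dom (AS A1 A21 S) x ->
  rip (AS A1 A21 S x) x <= - (nu * rnorm (A21 x) ^+ 2).
Proof.
move=> [d21 d1]; have [Te [C0e cTe gene]] := Aext_generates.
have cTe' t : 0 <= t -> nonexpansive (Te t).
  by move=> t0; apply: op_norm_le1P; exact: cTe.
have := @generator_dissipative _ _ _ _ gene cTe' (AS_arg A21 S x) (conj d1 d21).
rewrite /rip /= /inner /= /hprod_inner /= ReD.
by have := S_coercive (A21 x); rewrite /AS_fun; lra.
Qed.

Lemma T_nonexpansive t : 0 <= t -> nonexpansive (T t).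
Proof.
apply: (dissipative_nonexpansive C0 gen) => x /AS_dissipative h.
apply: (le_trans h); by rewrite oppr_le0 (mulr_ge0 (ltW nu0))// sqr_ge0.
Qed.

Local Notation cT := T_nonexpansive.

Lemma A1_first x : op_dom A1 ((x, 0) : hprod H1 H2) /\
  A1 ((x, 0) : hprod H1 H2) = A11 x.
Proof.
have [dom1 A1E] := A1_splits.
have d : op_dom A1 ((x, 0) : hprod H1 H2).
  by rewrite dom1; split; [exact: A11_dom|exact: op_dom0].
by split=> //; rewrite A1E//= op_fun0 addr0.
Qed.

Lemma hprod_rnorm_le (h : hprod H1 H2) : rnorm h <= rnorm h.1 + rnorm h.2.
Proof. by rewrite -lecR rmorphD /= -!rnormE hprod_norm_leD. Qed.

(** [Aext] is closed and maps [(x', 0)] to [(A11 x', A21 x')], where the first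
    component is continuous in [x']. *)
Lemma A21_closed x w :
  (forall e : R, 0 < e -> exists x', [/\ op_dom A21 x', rnorm (x' - x) <= e &
     rnorm (A21 x' - w) <= e]) -> op_dom A21 x /\ A21 x = w.
Proof.
move=> appr; have [Te [C0e cTe gene]] := Aext_generates.
have cTe' t : 0 <= t -> nonexpansive (Te t).
  by move=> t0; apply: op_norm_le1P; exact: cTe.
have [|[_ dx] E] := @generator_closed _ _ _ _ C0e gene cTe'
  ((x, 0) : hprod H1 H2) ((A11 x, w) : hprod H1 H2);
  last by split=> //; have := congr1 snd E.
move=> e e0.
have [M M0 hM] := bounded_opP A11_bounded.
have e20 : 0 < e / 2 by lra.
have M1 : 0 < M + 1 by lra.
have [x' [dx' xx' ww']] := appr _ (divr_gt0 e20 M1).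
rewrite ler_pdivlMr// in xx'; rewrite ler_pdivlMr// in ww'.
have x0 := rnorm_ge0 (x' - x); have w0 := rnorm_ge0 (A21 x' - w).
have xM := mulr_ge0 x0 (ltW M0); have wM := mulr_ge0 w0 (ltW M0).
exists ((x', 0) : hprod H1 H2); split.
- by split => //; have [] := A1_first x'.
- by apply: (le_trans (hprod_rnorm_le _)); rewrite /= subr0 rnorm0; lra.
- apply: (le_trans (hprod_rnorm_le _)); rewrite /= (A1_first x').2.
  rewrite -op_funB; [|exact: A11_dom..].
  by have := hM (x' - x); lra.
Qed.

Local Notation AS := (AS A1 A21 S).

(** Here the splitting matters: [(x, 0)] is in the domain of [A1] for every [x]. *)
Lemma AS_on_ker21 x : op_ker A21 x -> op_dom AS x /\ AS x = A11 x.
Proof.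
move=> [dx Ax]; have [d1 A1x] := A1_first x.
by rewrite /= /AS_dom /AS_fun /AS_arg /= Ax linear0.
Qed.

Lemma AS_ker x : op_dom AS x -> AS x = 0 -> op_ker A21 x /\ A11 x = 0.
Proof.
move=> dx ASx; have := AS_dissipative dx; rewrite ASx rip0l oppr_ge0.
rewrite pmulr_rle0// => h.
have k : op_ker A21 x.
  split; first by case: dx.
  by apply: rnorm0_eq0; apply/eqP; rewrite -sqrf_eq0 eq_le h sqr_ge0.
by split => //; have [_ <-] := AS_on_ker21 k.
Qed.

(** A dissipation rate above [c] throughout the time interval would make the
    squared norm decay by at least [c * t]. *)
Lemma small_dissipation x (t c : R) : 0 <= t -> op_dom AS x ->
  rnorm x ^+ 2 - rnorm (T t x) ^+ 2 < c * t ->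
  exists s : R, [/\ 0 <= s, s < t & 2 * nu * rnorm (A21 (T s x)) ^+ 2 <= c].
Proof.
move=> t0 dx hc; apply: contrapT => ns.
have h s : 0 <= s -> s < t -> 1 * (2 * rip (AS (T s x)) (T s x)) <= - c.
  move=> s0 st; have [dT _] := generator_invariant gen C0 s0 dx.
  have := AS_dissipative dT.
  have [cs|sc] := leP (2 * nu * rnorm (A21 (T s x)) ^+ 2) c; last by lra.
  by case: ns; exists s.
have := @energy_le _ _ _ _ C0 gen 1 (- c) x t _ t0 dx h.
by rewrite lexx andbT !mul1r mulNr => /(_ (le_trans (lerN10 _) ler01)); lra.
Qed.

(** [T 1] is compact. An orbit started in a ball cannot dissipate much, so it
    passes through a fixed ball of the graph norm during the first unit of time;
    the rest of the way depends continuously on the time and the point of that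
    passage. *)
Lemma time_one_compact (B : R) (x : nat -> H1) :
  (forall n, rnorm (x n) <= B) ->
  exists y, forall e : R, 0 < e -> forall N, exists2 n, (N <= n)%N &
    rnorm (T 1 (x n) - y) < e.
Proof.
move=> xB; have B0 : 0 <= B by apply: le_trans (xB 0%N); exact: rnorm_ge0.
have /choice[x' hx'] : forall n, exists x', op_dom AS x' /\
    rnorm (x' - x n) <= n.+1%:R^-1.
  move=> n; have n0 : 0 < n.+1%:R^-1 :> R by rewrite invr_gt0.
  by have [y dy yx] := generator_dense C0 gen (x n) n0; exists y.
have x'B n : rnorm (x' n) <= B + 1.
  have [_ h] := hx' n; have := rnormD (x' n - x n) (x n); rewrite subrK.
  have n1 : n.+1%:R^-1 <= 1 :> R by rewrite invf_le1// ler1n.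
  by have := xB n; have := le_trans h n1; lra.
pose c := (B + 1) ^+ 2 + 1.
have c1 : 1 <= c by rewrite /c lerDr sqr_ge0.
have /choice[s hs] : forall n, exists s : R, [/\ 0 <= s, s < 1 &
    2 * nu * rnorm (A21 (T s (x' n))) ^+ 2 <= c].
  move=> n; have [dx' _] := hx' n; apply: small_dissipation => //.
  rewrite mulr1 /c; have := x'B n; have := rnorm_ge0 (x' n).
  by have := sqr_ge0 (rnorm (T 1 (x' n))); nra.
pose w n := T (s n) (x' n).
(* [c] bounds the dissipation rate and the squared norm, so [k] bounds the
   squared graph norm of [w n]; as [1 <= k], so does its square. *)
pose k := c / (2 * nu) + c.
have nu20 : 0 < 2 * nu by rewrite mulr_gt0.
have k1 : 1 <= k.
  by rewrite /k (le_trans c1)// lerDr divr_ge0// ?(ltW nu20)// (le_trans ler01).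
have k0 : 0 < k := lt_le_trans ltr01 k1.
have wG n : [set u : H1 | op_dom A21 u /\ graph_norm A21 u <= 1] (rsc k^-1 (w n)).
  have [s0 s1 hd] := hs n; have [dx' _] := hx' n.
  have [[dw _] _] := generator_invariant gen C0 s0 dx'.
  split; first exact: op_domZ.
  rewrite /graph_norm -sqrtr1 ler_sqrt// /rsc op_funZ// -!/(rsc _ _).
  rewrite !rnormZ ?invr_ge0 ?(ltW k0)// !exprMn -mulrDr exprVn mulrC.
  rewrite ler_pdivrMr ?exprn_gt0// mul1r; apply: (@le_trans _ _ k); last first.
    by rewrite ler_eXnr.
  apply: lerD; first by rewrite ler_pdivlMr// mulrC.
  have w1 : rnorm (w n) <= B + 1 by apply: le_trans (x'B n); exact: cT.
  by rewrite /c; have := rnorm_ge0 (w n); nra.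
pose G := closure [set u : H1 | op_dom A21 u /\ graph_norm A21 u <= 1].
have cG : compact G by rewrite /G -precompactE.
have [] := @compact_seq (R * H1)%type (`[(0 : R), 1]%classic `*` G)
  (fun n => (s n, rsc k^-1 (w n))).
- by apply: compact_setX => //; exact: segment_compact.
- move=> n; have [s0 s1 _] := hs n; split => /=.
    by rewrite in_itv /= s0 ltW.
  by apply: subset_closure; exact: wG.
move=> [t p] [/= t01 _] cl.
rewrite in_itv /= in t01; have /andP[t0 t1] := t01.
have t1' : 0 <= 1 - t by lra.
exists (T (1 - t) (rsc k p)) => e e0 N.
have e40 : 0 < e / 4 by lra.
have [d d0 hd] := C0_cont C0 (rsc k p) t1' e40.
pose V : set R := [set r : R | t - d < r < t + d].
pose W : set H1 := [set z : H1 | rnorm (z - p) < e / 4 / k].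
have VW : nbhs (t, p) (V `*` W).
  exists (V, W) => //; split => /=.
    by exists d => //= r /=; rewrite /ball_ /= ltr_distlC.
  by apply: nbhs_rnorm; rewrite !divr_gt0.
have [N1 _ hN1] := near_infty_natSinv_lt (PosNum e40).
have [n nN [/= sV wW]] := cl _ VW (maxn N N1).
exists n; first by rewrite (leq_trans _ nN)// leq_maxl.
have [s0 s1 _] := hs n; have [_ xx'] := hx' n.
have {}xx' : rnorm (x' n - x n) <= e / 4.
  by apply: (le_trans xx'); apply/ltW/hN1; rewrite /= (leq_trans _ nN)// leq_maxr.
have s1' : 0 <= 1 - s n by lra.
have E : T 1 (x' n) = T (1 - s n) (w n).
  by rewrite /w -(semigroupD C0)// subrK.
have h1 : rnorm (T 1 (x n) - T 1 (x' n)) <= e / 4.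
  by rewrite -(linearB (T 1)) (le_trans (cT ler01 _))// rnormB.
have h2 : rnorm (T (1 - s n) (w n) - T (1 - s n) (rsc k p)) <= e / 4.
  rewrite -(linearB (T _)) (le_trans (cT s1' _))//.
  have -> : w n - rsc k p = rsc k (rsc k^-1 (w n) - p).
    by rewrite rscBr rscA divff ?rsc1// gt_eqF.
  rewrite rnormZ ?(ltW k0)// mulrC -ler_pdivlMr//; exact: ltW.
have h3 : rnorm (T (1 - s n) (rsc k p) - T (1 - t) (rsc k p)) < e / 4.
  by apply: hd => //; move/andP: sV => [? ?]; apply/andP; split; lra.
have := rnorm_trans (T 1 (x' n)) (T 1 (x n)) (T (1 - t) (rsc k p)).
have := rnorm_trans (T (1 - s n) (rsc k p)) (T 1 (x' n)) (T (1 - t) (rsc k p)).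
by rewrite -E in h2; lra.
Qed.

(** * The unitary part *)

(** The part of the space where the semigroup does not decay at all; every
    orbit approaches it. *)
Definition isometric_part : set H1 :=
  [set y | forall t, 0 <= t -> rnorm (T t y) = rnorm y].

Local Notation M := isometric_part.

Lemma isometric_partZ (a : R[i]) y : M y -> M (a *: y).
Proof.
move=> My t t0; apply: (@complexI R); rewrite linearZ -!rnormE !normrZ !rnormE.
by rewrite My.
Qed.

(** By the parallelogram law the two inequalities for [y + z] and [y - z] add up
    to an equality. *)
Lemma isometric_partD y z : M y -> M z -> M (y + z).
Proof.
move=> My Mz t t0; apply/eqP; rewrite eq_le (cT t0) /=.
have h := cT t0 (y - z); rewrite -ler_sqr ?nnegrE ?rnorm_ge0// in h.
rewrite -ler_sqr ?nnegrE ?rnorm_ge0//; move: h.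
rewrite (linearB (T t)) (linearD (T t)) !sqnormB !sqnormD !My// !Mz//; lra.
Qed.

Lemma isometric_part_rip y z t : M y -> M z -> 0 <= t ->
  rip (T t y) (T t z) = rip y z.
Proof.
move=> My Mz t0; have := isometric_partD My Mz t0.
move=> /(congr1 (fun r => r ^+ 2)); rewrite (linearD (T t)) !sqnormD My// Mz//.
by lra.
Qed.

Lemma isometric_part_T y t : 0 <= t -> M y -> M (T t y).
Proof.
move=> t0 My s s0; rewrite -(semigroupD C0)// !My//; exact: addr_ge0.
Qed.

Lemma isometric_part_closed y :
  (forall e : R, 0 < e -> exists2 z, M z & rnorm (z - y) <= e) -> M y.
Proof.
move=> appr t t0; apply/eqP; rewrite eq_le (cT t0) /=.
apply/ler_addgt0Pr => e e0; have [z Mz zy] := appr (e / 2) ltac:(lra).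
have := rnorm_trans z y 0; have := rnorm_trans (T t y) (T t z) 0.
rewrite !subr0 -(linearB (T t)) (Mz t t0) (rnormB y z).
by have := cT t0 (z - y); lra.
Qed.

(** No dissipation takes place along the orbit of [y]; approximating [y] from the
    domain, there are arbitrarily small times at which the dissipation rate is
    arbitrarily small, and [A21] is closed. *)
Lemma isometric_part_ker21 y : M y -> op_ker A21 y.
Proof.
move=> My; apply: A21_closed => e e0.
have e20 : 0 < e / 2 by lra.
have [d d0 hd] := C0_cont0 C0 y e20.
have y0 := rnorm_ge0 y.
pose c := 2 * nu * e ^+ 2.
have c0 : 0 < c by rewrite !mulr_gt0// exprn_gt0.
have k0 : 0 < 4 * rnorm y + 4 by lra.
pose r := Num.min (Num.min 1 (e / 2)) (c * d / (4 * rnorm y + 4)).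
have r0 : 0 < r by rewrite !lt_min ltr01 e20 divr_gt0// mulr_gt0.
have r1 : r <= 1 by rewrite !ge_min lexx.
have re : r <= e / 2 by rewrite !ge_min lexx orbT.
have rc : r * (4 * rnorm y + 4) <= c * d by rewrite -ler_pdivlMr// ge_min lexx orbT.
have [x dx xy] := generator_dense C0 gen y r0.
have [s [s0 sd hs]] : exists s : R, [/\ 0 <= s, s < d &
    2 * nu * rnorm (A21 (T s x)) ^+ 2 <= c].
  apply: small_dissipation => //; first exact: ltW.
  have n1 : rnorm x <= rnorm y + r.
    by have := rnormD (x - y) y; rewrite subrK; lra.
  have n2 : rnorm y - r <= rnorm (T d x).
    have := rnorm_trans (T d x) (T d y) 0; rewrite !subr0 -(linearB (T d)).
    by rewrite (My d (ltW d0)); have := cT (ltW d0) (y - x); rewrite (rnormB y x); lra.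
  have x0 := rnorm_ge0 x; have Tx0 := rnorm_ge0 (T d x).
  have n3 : rnorm (T d x) <= rnorm x by exact: cT (ltW d0) x.
  apply: lt_le_trans rc.
  have : rnorm x ^+ 2 - rnorm (T d x) ^+ 2 <= 2 * r * (2 * (rnorm y + r)).
    by rewrite subr_sqr; apply: ler_pM; lra.
  nra.
have [[dT _] _] := generator_invariant gen C0 s0 dx.
exists (T s x); split => //.
  have := rnorm_trans (T s y) (T s x) y; rewrite -(linearB (T s)).
  by have := cT s0 (x - y); have := hd s s0 (ltW sd); lra.
rewrite subr0 -ler_sqr ?nnegrE ?rnorm_ge0 ?(ltW e0)//.
by move: hs; rewrite /c ler_pM2l// mulr_gt0.
Qed.

Lemma isometric_part_AS y : M y -> op_dom AS y /\ AS y = A11 y.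
Proof. by move=> /isometric_part_ker21 /AS_on_ker21. Qed.

Lemma isometric_part_A11 y : M y -> M (A11 y).
Proof.
move=> My; apply: isometric_part_closed => e e0.
have [dy Ay] := isometric_part_AS My.
have [d d0 hd] := generator_right_deriv gen dy e0.
pose h := d / 2.
have h0 : 0 < h by rewrite divr_gt0.
have hlt : 0 < h < d by rewrite h0 /h; lra.
exists (rsc h^-1 (T h y - y)).
  apply: isometric_partZ; rewrite -[- y]scaleN1r; apply: isometric_partD.
    by apply: isometric_part_T => //; exact: ltW.
  exact: isometric_partZ.
have -> : rsc h^-1 (T h y - y) - A11 y = rsc h^-1 (T h y - y - rsc h (A11 y)).
  by rewrite [RHS]rscBr rscA mulVf ?gt_eqF// rsc1.
rewrite rnormZ ?invr_ge0 ?(ltW h0)// mulrC ler_pdivrMr// -Ay; exact: hd.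
Qed.

(** Along the orbit of [y] the rate of change of the squared norm is constant,
    since the semigroup preserves inner products on [M], and its total change
    is zero. *)
Lemma isometric_part_rip0 y : M y -> rip (A11 y) y = 0.
Proof.
move=> My; have [dy Ay] := isometric_part_AS My; apply/eqP.
rewrite eq_le -Ay (generator_dissipative gen cT dy) /=.
have h s : 0 <= s -> s < 1 -> 1 * (2 * rip (AS (T s y)) (T s y)) <= 2 * rip (AS y) y.
  move=> s0 _; have [_ ->] := generator_invariant gen C0 s0 dy.
  rewrite Ay isometric_part_rip// ?mul1r//; exact: isometric_part_A11.
have := @energy_le _ _ _ _ C0 gen 1 _ y 1 _ ler01 dy h.
by rewrite My// subrr mulr1 lexx andbT => /(_ (le_trans (lerN10 _) ler01)); lra.
Qed.

Lemma isometric_part_skew y z : M y -> M z -> rip (A11 y) z = - rip (A11 z) y.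
Proof.
move=> My Mz; have := isometric_part_rip0 (isometric_partD My Mz).
rewrite op_funD; [|exact: A11_dom..].
rewrite ripDl !ripDr !isometric_part_rip0//; lra.
Qed.

(** If the skew operator [A11] is not zero on [M], it has an eigenvector there for
    [i mu] or [- i mu], where [mu] is its norm on [M]. The norm is attained,
    since on [M] the graph norm of [A21] is the norm of [H1]; at a vector [p] of
    the unit ball where it is attained the Cauchy-Schwarz inequality is an
    equality, that is [A11 (A11 p) = - mu^2 p], and [A11^2 + mu^2] is the product
    of [A11 - i mu] and [A11 + i mu]. *)
Lemma isometric_part_A11_eq0 :
  (forall w : R, w != 0 ->
     op_ker A21 `&` op_ker (shift_op (0 +i* w)%C A11) = [set 0]) ->
  forall y, M y -> A11 y = 0.
Proof.
move=> noeig y My; apply/eqP/negPn/negP => Ay0.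
have eig0 (w : R) z : w != 0 -> M z -> A11 z = (0 +i* w)%C *: z -> z = 0.
  move=> w0 Mz Az; suff : [set 0] z by [].
  rewrite -(noeig w w0); split; first exact: isometric_part_ker21.
  by split; [exact: A11_dom|rewrite /= Az subrr].
pose E := [set rnorm (A11 z) | z in [set z | M z /\ rnorm z <= 1]].
have [C C0' hC] := bounded_opP A11_bounded.
have EC : has_sup E.
  have M0 : M 0 by rewrite -(scale0r y); exact: isometric_partZ.
  split; first by exists (rnorm (A11 0)); exists 0 => //; split; rewrite ?rnorm0.
  exists C => _ [z [_ z1] <-]; apply: (le_trans (hC z)).
  by rewrite ler_piMr// ltW.
pose mu := sup E.
have Emu z : M z -> rnorm (A11 z) <= mu * rnorm z.
  move=> Mz; have [z0|z0] := eqVneq (rnorm z) 0.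
    by rewrite z0 mulr0 (rnorm0_eq0 z0) op_fun0 rnorm0.
  have zp : 0 < rnorm z by rewrite lt0r z0 rnorm_ge0.
  rewrite -ler_pdivrMr// mulrC -rnormZ ?invr_ge0 ?(ltW zp)//.
  rewrite /rsc -op_funZ; last exact: A11_dom.
  apply: ub_le_sup; first by case: EC.
  exists ((rnorm z)^-1%:C%C *: z) => //; split; first exact: isometric_partZ.
  by rewrite -/(rsc _ _) rnormZ ?invr_ge0 ?(ltW zp)// mulVf.
have mu0 : 0 < mu.
  have Ay : 0 < rnorm (A11 y).
    by rewrite lt0r rnorm_ge0 andbT; apply: contra Ay0 => /eqP/rnorm0_eq0 ->.
  have := lt_le_trans Ay (Emu y My); have := rnorm_ge0 y; nra.
have [p [Mp p1 hp]] : exists p, [/\ M p, rnorm p <= 1 & mu <= rnorm (A11 p)].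
  have /choice[u hu] : forall n, exists u, [/\ M u, rnorm u <= 1 &
      mu - n.+1%:R^-1 <= rnorm (A11 u)].
    move=> n; have n0 : 0 < n.+1%:R^-1 :> R by rewrite invr_gt0.
    have [_ [u [Mu u1] <-] lt] := sup_adherent n0 EC.
    by exists u; split => //; exact: ltW.
  have [|n|p _ cl] := @compact_seq H1
    (closure [set u : H1 | op_dom A21 u /\ graph_norm A21 u <= 1]) u.
  - by rewrite -precompactE.
  - have [Mu u1 _] := hu n; have [du Au] := isometric_part_ker21 Mu.
    apply: subset_closure; split => //.
    rewrite /graph_norm Au rnorm0 expr0n add0r sqrtr_sqr ger0_norm//.
    exact: rnorm_ge0.
  have near (e : R) N : 0 < e -> exists2 n, (N <= n)%N & rnorm (u n - p) < e.
    by move=> e0; have [n] := cl _ (nbhs_rnorm p e0) N; exists n.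
  exists p; split.
  - apply: isometric_part_closed => e e0; have [n _ np] := near e 0%N e0.
    by exists (u n); [case: (hu n)|exact: ltW].
  - apply/ler_addgt0Pr => e e0; have [n _ np] := near e 0%N e0.
    have [_ u1 _] := hu n; have := rnorm_trans (u n) p 0; rewrite !subr0.
    by rewrite (rnormB p); lra.
  - apply/ler_addgt0Pr => e e0.
    have e20 : 0 < e / 2 by lra.
    have [N1 _ hN1] := near_infty_natSinv_lt (PosNum e20).
    have [n nN np] := near (e / 2 / C) N1 (divr_gt0 e20 C0').
    have [_ _ hn] := hu n.
    have := hN1 n nN => /= hn1; have {hn hn1} h1 : mu - e / 2 <= rnorm (A11 (u n)).
      by apply: le_trans hn; rewrite lerD2l lerN2 ltW.
    have := rnorm_trans (A11 p) (A11 (u n)) 0; rewrite !subr0.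
    rewrite -op_funB; [|exact: A11_dom..].
    have := hC (u n - p); move: np; rewrite ltr_pdivlMr// mulrC.
    lra.
set v := A11 p in hp.
have Mv : M v by exact: isometric_part_A11.
have vmu : rnorm v = mu.
  by apply/eqP; rewrite eq_le hp andbT (le_trans (Emu p Mp))// ler_piMr// ltW.
have Av : A11 v = - rsc (mu ^+ 2) p.
  apply/eqP; rewrite -subr_eq0 opprK; apply/eqP/rnorm0_eq0/eqP.
  rewrite -sqrf_eq0 eq_le sqr_ge0 andbT.
  rewrite sqnormD ripZr isometric_part_skew// -/v ripxx vmu.
  rewrite rnormZ ?sqr_ge0// exprMn.
  have h1 : rnorm (A11 v) ^+ 2 <= (mu * mu) ^+ 2.
    by rewrite ler_sqr ?nnegrE ?rnorm_ge0 ?(mulr_ge0 (ltW mu0) (ltW mu0))// -{2}vmu Emu.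
  have h2 : rnorm p ^+ 2 <= 1 by rewrite expr_le1// rnorm_ge0.
  have h3 : 0 <= (mu ^+ 2) ^+ 2 by exact: sqr_ge0.
  have : (mu ^+ 2) ^+ 2 * rnorm p ^+ 2 <= (mu ^+ 2) ^+ 2 by rewrite ler_piMr.
  by move: h1; rewrite -expr2; lra.
have imu : (0 +i* mu)%C * (0 +i* mu)%C = (- (mu ^+ 2))%:C%C :> R[i].
  by rewrite /GRing.mul /= !mul0r !mulr0 sub0r addr0 expr2.
have z0 : v + (0 +i* mu)%C *: p = 0.
  apply: (eig0 mu) => //; first by rewrite gt_eqF.
    by apply: isometric_partD => //; exact: isometric_partZ.
  rewrite op_funD; [|exact: A11_dom..]; rewrite op_funZ; last exact: A11_dom.
  by rewrite Av -/v scalerDr scalerA imu addrC /rsc rmorphN scaleNr.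
(* The factor [A11 - i mu] is gone; now the other one. *)
have p0 : p = 0.
  apply: (eig0 (- mu)) => //; first by rewrite oppr_eq0 gt_eqF.
  rewrite -/v; apply/eqP; rewrite -subr_eq0 -scaleNr; apply/eqP.
  rewrite -[RHS]z0; congr (_ + _ *: _).
  by apply/eqP; rewrite eq_complex /= oppr0 opprK !eqxx.
by move: vmu mu0; rewrite /v p0 op_fun0 rnorm0 => ->; rewrite ltxx.
Qed.

(** * Convergence of the semigroup *)

Definition orbit_tends (x z : H1) : Prop :=
  forall e : R, 0 < e -> exists2 t0 : R, 0 <= t0 &
    forall t, t0 <= t -> rnorm (T t x - z) <= e.

Lemma orbit_tends_unique x y z : orbit_tends x y -> orbit_tends x z -> y = z.
Proof.
move=> xy xz; apply/eqP; rewrite -subr_eq0; apply/eqP.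
apply: (@rnorm_eq0_le _ _ _ 2) => // e e0.
have [t0 _ h1] := xy e e0; have [t1 _ h2] := xz e e0.
have := h1 (Num.max t0 t1) ltac:(by rewrite le_max lexx).
have := h2 (Num.max t0 t1) ltac:(by rewrite le_max lexx orbT).
have := rnorm_trans (T (Num.max t0 t1) x) y z.
by rewrite (rnormB y (T _ x)); lra.
Qed.

Lemma orbit_tends_shift x z s : 0 <= s -> orbit_tends x z -> orbit_tends (T s x) z.
Proof.
move=> s0 xz e e0; have [t0 t00 h] := xz e e0; exists t0 => // t tt.
by rewrite -(semigroupD C0)//; [apply: h; lra|lra].
Qed.

Lemma orbit_tends_T x z s : 0 <= s -> orbit_tends x z -> orbit_tends (T s x) (T s z).
Proof.
move=> s0 xz e e0; have [t0 t00 h] := xz e e0; exists t0 => // t tt.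
rewrite (C0_comm C0 _ (le_trans t00 tt) s0) -(linearB (T s)).
exact: le_trans (cT s0 _) (h t tt).
Qed.

Lemma orbit_tends_fixed x z s : 0 <= s -> orbit_tends x z -> T s z = z.
Proof.
move=> s0 xz.
exact: orbit_tends_unique (orbit_tends_T s0 xz) (orbit_tends_shift s0 xz).
Qed.

Lemma orbit_tends_linear a x y z w : orbit_tends x z -> orbit_tends y w ->
  orbit_tends (a *: x + y) (a *: z + w).
Proof.
move=> xz yw e e0.
pose k := complex.Re `|a|.
have k0 : 0 <= k by rewrite -ler0c /k RRe_real ?normr_real.
have k1 : 0 < k + 1 by lra.
have e20 : 0 < e / 2 by lra.
have [t0 t00 h1] := xz _ (divr_gt0 e20 k1); have [t1 _ h2] := yw _ e20.
exists (Num.max t0 t1) => [|t]; first by rewrite le_max t00.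
rewrite ge_max => /andP[tt0 tt1].
rewrite (linearP (T t)) opprD addrACA -scalerBr.
have := rnormD (a *: (T t x - z)) (T t y - w).
have -> : rnorm (a *: (T t x - z)) = k * rnorm (T t x - z).
  by rewrite {1}/rnorm normrZ rnormE mulrC Re_realM mulrC.
have := h1 t tt0; rewrite ler_pdivlMr// => h3.
by have := h2 t tt1; have := rnorm_ge0 (T t x - z); lra.
Qed.

(** A cluster point of an orbit has an isometric orbit, because the norm
    decreases along the former; it is then a fixed point, and an orbit that
    comes close to a fixed point stays close to it. *)
Lemma orbit_converges x :
  (forall y, isometric_part y -> A11 y = 0) -> exists z, orbit_tends x z.
Proof.
move=> A11_0.
have xB n : rnorm (T n%:R x) <= rnorm x by exact: cT.
have [z hz] := time_one_compact xB.
have n10 n : 0 <= 1 + n%:R :> R by rewrite addr_ge0.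
have near e N : 0 < e -> exists2 n, (N <= n)%N & rnorm (T (1 + n%:R) x - z) < e.
  move=> e0; have [n nN hn] := hz e e0 N; exists n => //.
  by rewrite (semigroupD C0).
exists z.
have Mz : isometric_part z.
  move=> t t0; apply/eqP; rewrite eq_le (cT t0) /=.
  apply/ler_addgt0Pr => e e0; have e20 : 0 < e / 2 by lra.
  have [n _ hn] := near _ 0%N e20.
  have [m mN hm] := near _ (Num.truncn (t + n%:R)).+1 e20.
  have tm : t + n%:R <= m%:R.
    apply/ltW/(lt_le_trans (truncnS_gt _)); by rewrite ler_nat.
  have n1 : rnorm (T (1 + m%:R) x) <= rnorm (T (t + (1 + n%:R)) x).
    have -> : 1 + m%:R = (m%:R - (t + n%:R)) + (t + (1 + n%:R)) :> R by ring.
    rewrite (semigroupD C0); first by apply: cT; lra.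
      lra.
    by have : 0 <= n%:R :> R by []; lra.
  have n2 : rnorm (T (t + (1 + n%:R)) x) <= rnorm (T t z) + e / 2.
    rewrite (semigroupD C0 _ t0 (n10 n)).
    have := rnorm_trans (T t z) (T t (T (1 + n%:R) x)) 0; rewrite !subr0 -(linearB (T t)).
    by have := cT t0 (T (1 + n%:R) x - z); lra.
  have := rnorm_trans (T (1 + m%:R) x) z 0; rewrite !subr0 (rnormB z).
  lra.
have [dz Az] := isometric_part_AS Mz.
have Tz t : 0 <= t -> T t z = z.
  by move=> t0; apply: (kernel_fixed C0 gen) => //; rewrite Az A11_0.
move=> e e0; have [n _ hn] := near e 0%N e0.
exists (1 + n%:R) => [|t tn]; first exact: n10.
have tn0 : 0 <= t - (1 + n%:R) by lra.
rewrite -(subrK (1 + n%:R) t) (semigroupD C0 _ tn0 (n10 n)).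
by rewrite -(Tz _ tn0) -(linearB (T _)) (le_trans (cT tn0 _))// ltW.
Qed.

Lemma orbit_limit_op : (forall y, isometric_part y -> A11 y = 0) ->
  exists P : {linear H1 -> H1}, forall x, orbit_tends x (P x).
Proof.
move=> A11_0.
have /choice[P hP] : forall x, exists z, orbit_tends x z.
  by move=> x; exact: orbit_converges.
have Plin : linear P.
  move=> a x y; apply: orbit_tends_unique (hP _) _.
  exact: orbit_tends_linear.
pose Pl : {linear H1 -> H1} := HB.pack P (GRing.isLinear.Build _ _ _ _ P Plin).
by exists Pl.
Qed.

(** Pointwise convergence of contractions is uniform on the closure of the image
    of the unit ball under [T 1], which is compact. *)
Lemma orbit_limit_uniform (P : {linear H1 -> H1}) :
  (forall x, orbit_tends x (P x)) -> op_norm_cvg T P.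
Proof.
move=> hP.
have TP t x : 0 <= t -> T t (P x) = P x by move=> t0; exact: orbit_tends_fixed.
have PT t x : 0 <= t -> P (T t x) = P x.
  move=> t0; apply: orbit_tends_unique (hP _) _; exact: orbit_tends_shift.
have cP x : rnorm (P x) <= rnorm x.
  apply/ler_addgt0Pr => e e0; have [t t0 ht] := hP x e e0.
  have := rnorm_trans (T t x) (P x) 0; rewrite !subr0 (rnormB (P x)).
  by have := ht t (lexx t); have := cT t0 x; lra.
apply/op_norm_cvgP => e e0.
suff [n hn] : exists n : nat, forall x, rnorm x <= 1 -> rnorm (T n%:R x - P x) <= e.
  exists n%:R => // t nt x.
  have tn : 0 <= t - n%:R by lra.
  apply: (@unit_ball_scale _ _ x e (fun z => rnorm (T t z - P z))) => [r y r0|y y1].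
    by rewrite (linear_rsc (T t)) (linear_rsc P) -rscBr rnormZ.
  rewrite -(subrK n%:R t) (semigroupD C0)// -(TP _ y tn) -(linearB (T _)).
  exact: le_trans (cT tn _) (hn y y1).
apply: contrapT => nn.
have /choice[x hx] : forall n, exists x, rnorm x <= 1 /\ e < rnorm (T n%:R x - P x).
  move=> n; apply: contrapT => nx; apply: nn; exists n => x x1.
  by rewrite leNgt; apply/negP => lt; apply: nx; exists x.
have [y hy] := time_one_compact (fun n => (hx n).1).
have e30 : 0 < e / 3 by lra.
have [t1 t10 ht1] := hP y _ e30.
have [n nN hn] := hy _ e30 (Num.truncn t1).+2.
have [_ lt] := hx n.
have n1 : (0 < n)%N by apply: leq_trans nN.
have tn : t1 <= n.-1%:R.
  apply/ltW/(lt_le_trans (truncnS_gt _)); rewrite ler_nat.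
  by rewrite -ltnS prednK.
have E : n%:R = n.-1%:R + 1 :> R by rewrite natr1 prednK.
set z := T 1 (x n) in hn.
have Pz : P (x n) = P z by rewrite /z PT.
move: lt; rewrite Pz E (semigroupD C0)// -/z.
have h1 := ht1 _ tn.
have h2 : rnorm (T n.-1%:R z - T n.-1%:R y) <= rnorm (z - y).
  by rewrite -(linearB (T _)); exact: cT.
have h3 : rnorm (P y - P z) <= rnorm (z - y).
  by rewrite -(linearB P) rnormB (le_trans (cP _)).
have := rnorm_trans (T n.-1%:R y) (T n.-1%:R z) (P z).
have := rnorm_trans (P y) (T n.-1%:R y) (P z).
lra.
Qed.

Lemma op_norm_cvg_orbit (P : {linear H1 -> H1}) : op_norm_cvg T P ->
  forall x, orbit_tends x (P x).
Proof.
move=> /op_norm_cvgP cv x e e0.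
have x1 : 0 < rnorm x + 1 by have := rnorm_ge0 x; lra.
have [t0 t00 h] := cv _ (divr_gt0 e0 x1); exists t0 => // t tt.
apply: (le_trans (h t tt x)); rewrite mulrAC ler_pdivrMr//.
by rewrite ler_pM2l// lerDl.
Qed.

Section Eigenvector.
Variables (w : R) (x : H1).
Hypothesis x_eig : (op_ker A21 `&` op_ker (shift_op (0 +i* w)%C A11)) x.

Lemma eigenvector_AS : op_dom AS x /\ AS x = (0 +i* w)%C *: x.
Proof.
have [k [_ /= /eqP]] := x_eig; rewrite subr_eq0 => /eqP ->.
exact: AS_on_ker21.
Qed.

(** The orbit consists of eigenvectors for the same eigenvalue [i w], and
    [rip (i w u) u] vanishes, so the norm does not decay. *)
Lemma eigenvector_isometric t : 0 <= t -> rnorm x <= rnorm (T t x).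
Proof.
move=> t0; have [dx Ax] := eigenvector_AS.
have rip_i u : rip ((0 +i* w)%C *: u) u = 0.
  rewrite /rip linearZl_LR /= inner_norm rnormE -rmorphXn.
  by rewrite mulrC Re_realM mulr0.
have h s : 0 <= s -> s < t -> -1 * (2 * rip (AS (T s x)) (T s x)) <= 0.
  move=> s0 _; have [_ ->] := generator_invariant gen C0 s0 dx.
  by rewrite Ax linearZ rip_i !mulr0.
have := @energy_le _ _ _ _ C0 gen (-1) 0 x t _ t0 dx h.
rewrite lexx (le_trans (lerN10 _) ler01) mul0r => /(_ isT) h2.
by rewrite -ler_sqr ?nnegrE ?rnorm_ge0//; move: h2; lra.
Qed.

(** A limit of the orbit is fixed, hence in the kernel of [AS]; as [AS] is
    closed, it also satisfies the eigenvalue equation. *)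
Lemma eigenvector_limit0 z : w != 0 -> orbit_tends x z -> z = 0.
Proof.
move=> w0 xz; have [dx Ax] := eigenvector_AS.
have [dz Az0] := fixed_kernel gen (fun t t0 => orbit_tends_fixed t0 xz).
have [_ Az] : op_dom AS z /\ AS z = (0 +i* w)%C *: z.
  apply: (generator_closed C0 gen cT) => e e0.
  have w1 : 0 < `|w| + 1 by rewrite ltr_wpDl.
  have [t t0 ht] := xz _ (divr_gt0 e0 w1).
  have {}ht := ht t (lexx t); rewrite ler_pdivlMr// in ht.
  have [dT AT] := generator_invariant gen C0 t0 dx.
  exists (T t x); split => //.
    apply: le_trans ht; rewrite ler_peMr ?rnorm_ge0//.
    by rewrite lerDr.
  rewrite AT Ax linearZ -scalerBr; apply: le_trans ht.
  have -> : rnorm ((0 +i* w)%C *: (T t x - z)) = `|w| * rnorm (T t x - z).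
    rewrite {1}/rnorm normrZ normc_def /= expr0n add0r sqrtr_sqr.
    by rewrite Re_realM.
  by rewrite mulrC ler_wpM2l ?rnorm_ge0// lerDl.
apply/eqP; move/eqP: Az; rewrite Az0 eq_sym scaler_eq0 => /orP[|//].
by rewrite eq_complex /= (negbTE w0) andbF.
Qed.

End Eigenvector.

(** The two cases are those in which the orbit of [x] must tend to zero. *)
Lemma eigenvector_eq0 (w : R) (P : {linear H1 -> H1}) x : op_norm_cvg T P ->
  w != 0 \/ (forall z, P z = 0) ->
  (op_ker A21 `&` op_ker (shift_op (0 +i* w)%C A11)) x -> x = 0.
Proof.
move=> /op_norm_cvg_orbit cv wP xk; have xP := cv x.
have Px0 : P x = 0 by case: wP => // w0; exact: (eigenvector_limit0 xk).
apply: (@rnorm_eq0_le _ _ _ 1) => // e e0; rewrite mulr1.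
have [t t0 ht] := xP e e0; have := ht t (lexx t); rewrite Px0 subr0.
exact: le_trans (eigenvector_isometric xk t0).
Qed.

(** The kernel consists of fixed points of the semigroup, and a contraction does
    not change the component of a vector along its fixed points. *)
Lemma limit_orthogonal_projection (P : {linear H1 -> H1}) : op_norm_cvg T P ->
  is_orthogonal_projection (op_ker A21 `&` op_ker A11) P.
Proof.
move=> /op_norm_cvg_orbit cv x; have xP := cv x.
have [dP AP] := fixed_kernel gen (fun t t0 => orbit_tends_fixed t0 xP).
have [kP A11P] := AS_ker dP AP.
split; first by split => //; split => //; exact: A11_dom.
move=> y [ky [_ A11y]]; apply: inner_rip0 => a.
have [dy ASy] := AS_on_ker21 ky.
have Ty t : 0 <= t -> T t (a *: y) = a *: y.
  move=> t0; rewrite linearZ (kernel_fixed C0 gen)//.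
  by rewrite ASy.
set u := a *: y in Ty *.
suff : forall e : R, 0 < e -> `|rip (x - P x) u| <= e * (rnorm u + 1).
  move=> h; apply/eqP; rewrite -normr_le0.
  have u1 : 0 < rnorm u + 1 by have := rnorm_ge0 u; lra.
  apply/ler_addgt0Pr => e e0; rewrite add0r.
  by have := h _ (divr_gt0 e0 u1); rewrite divfK// gt_eqF.
move=> e e0; have [t t0 ht] := xP e e0; have {}ht := ht t (lexx t).
rewrite ripBl -(nonexpansive_fixed x (cT t0) (Ty t t0)) -ripBl.
have u0 := rnorm_ge0 u.
have le : rnorm (T t x - P x) * rnorm u <= e * (rnorm u + 1).
  by apply: ler_pM; rewrite ?rnorm_ge0 ?lerDl.
rewrite ler_norml (le_trans (rip_le _ _) le) andbT.
by apply: le_trans (rip_ge _ _); rewrite lerN2.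
Qed.

End System.

Theorem theorem3p14 (R : realType) (H1 H2 : hilbertType R)
    (H1_neq0 : exists x : H1, x != 0) (H2_neq0 : exists x : H2, x != 0)
    (A1 : lin_op (hprod H1 H2) H1) (A21 : lin_op H1 H2)
    (S : {linear H2 -> H2})
    (S_bounded : bounded_op S) (S_coercive : coercive S)
    (A11 : lin_op H1 H1) (A12 : lin_op H2 H1)
    (A1_splits : splitting A1 A11 A12)
    (A11_everywhere : op_dom A11 = setT) (A11_bounded : bounded_op A11)
    (Aext_generates : generates_contractive_C0_semigroup (Aext A1 A21))
    (A21_compact : graph_embeds_compactly A21)
    (T : R -> {linear H1 -> H1})
    (T_semigroup : C0_semigroup T) (T_generator : is_generator T (AS A1 A21 S)) :
  (exponentially_stable T <->
    forall w : R,
      op_ker A21 `&` op_ker (shift_op (0 +i* w)%C A11) = [set 0])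
  /\
  (((exists P : {linear H1 -> H1}, op_norm_cvg T P) <->
    forall w : R, w != 0 ->
      op_ker A21 `&` op_ker (shift_op (0 +i* w)%C A11) = [set 0])
   /\
   (forall P : {linear H1 -> H1}, op_norm_cvg T P ->
     is_orthogonal_projection (op_ker A21 `&` op_ker A11) P)).
Proof.
have [nu nu0 S_nu] := S_coercive.
have trivial_kernel (w : R) (P : {linear H1 -> H1}) : op_norm_cvg T P ->
    w != 0 \/ (forall z, P z = 0) ->
    op_ker A21 `&` op_ker (shift_op (0 +i* w)%C A11) = [set 0].
  move=> cv wP; apply/seteqP; split => [x|_ ->].
    move=> /(eigenvector_eq0 A1_splits A11_everywhere Aext_generates
      T_semigroup T_generator nu0 S_nu cv wP) ->; by [].
  split; first by split; [exact: op_dom0|exact: op_fun0].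
  by split; [exact: op_dom0|exact: op_fun0].
have proj (P : {linear H1 -> H1}) : op_norm_cvg T P ->
    is_orthogonal_projection (op_ker A21 `&` op_ker A11) P.
  exact: (limit_orthogonal_projection A1_splits A11_everywhere
    Aext_generates T_semigroup T_generator nu0 S_nu).
have cvg : (forall w : R, w != 0 ->
      op_ker A21 `&` op_ker (shift_op (0 +i* w)%C A11) = [set 0]) ->
    exists P : {linear H1 -> H1}, op_norm_cvg T P.
  move=> noeig.
  have A11_0 := isometric_part_A11_eq0 A1_splits A11_everywhere A11_bounded
    Aext_generates A21_compact T_semigroup T_generator nu0 S_nu noeig.
  have [P hP] := orbit_limit_op A1_splits A11_everywhere A11_bounded
    Aext_generates A21_compact T_semigroup T_generator nu0 S_nu A11_0.
  exists P; exact: (orbit_limit_uniform Aext_generates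
    A21_compact T_semigroup T_generator nu0 S_nu hP).
split; [split=> [st w|noeig]|split; [split=> [[P cv] w w0|]|]] => //.
- by apply: (trivial_kernel w \0) => //; right.
- have [P cv] := cvg (fun w _ => noeig w).
  have P0 x : P x = 0.
    have [[kP [dP AP]] _] := proj P cv x.
    suff : [set 0] (P x) by [].
    rewrite -(noeig 0); split => //; split => //=.
    by rewrite AP subr0 -[(0 +i* 0)%C]/(0 : R[i]) scale0r.
  move: cv; rewrite /exponentially_stable /op_norm_cvg.
  suff -> : (fun t => op_norm (T t \- P)) = (fun t => op_norm (T t \- \0)) by [].
  by apply/funext => t; congr op_norm; apply/funext => x /=; rewrite P0.
- by apply: trivial_kernel cv _; left.
Qed.
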